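(* In the linear oblivious setting described in the context, suppose $[T]$ is partitioned into $m$ disjoint nonempty sets $I_1,\dots,I_m$ with $|I_u|=T_u$ such that $\{x_t: t\in I_u\}$ lies in a linear subspace of $\mathbb{R}^d$ of dimension $d_u$. Run QuFUR$(\alpha)$ with inputs $d,T,C,\eta,\alpha$. Then with probability at least $1-\delta$: 1. its query complexity satisfies $Q=\tilde O\big(\sum_{u=1}^m \min\{T_u,\ \tilde\eta\sqrt{\alpha d_u T_u}\}+1\big)$; 2. its regret satisfies $R=\tilde O\big(\sum_{u=1}^m \max\{\tilde\eta^2 d_u,\ \tilde\eta\sqrt{d_uT_u/\alpha}\}\big)$.
   Context: Linear oblivious setting: fix integers $d,T\ge 1$, reals $C>0$, $\eta\ge 0$, $\delta\in(0,1)$, and let $\tilde\eta=\max\{1,\eta\}$. An unknown $\theta^*\in\mathbb{R}^d$ with $\|\theta^*\|_2\le C$ and a sequence $x_1,\dots,x_T\in\mathbb{R}^d$ with $\|x_t\|_2\le 1$ and $|\langle\theta^*,x_t\rangle|\le 1$ are fixed before the interaction (oblivious adversary). Labels are $y_t=\langle\theta^*,x_t\rangle+\xi_t$, where the $\xi_t$ are independent zero-mean sub-Gaussian random variables with variance proxy $\eta^2$, independent of the learner's internal randomness. At each round $t=1,\dots,T$ the learner sees $x_t$, predicts $\hat y_t\in[-1,1]$, then chooses $q_t\in\{0,1\}$; if $q_t=1$ it observes $y_t$. Query complexity: $Q=\sum_{t=1}^T q_t$. Regret: $R=\sum_{t=1}^T(\hat y_t-\langle\theta^*,x_t\rangle)^2$.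 Notation: $\mathrm{clip}(z)=\min(1,\max(-1,z))$; $\|v\|_M=\sqrt{v^\top M v}$. $\tilde O(\cdot)$ hides absolute constants and factors polylogarithmic in $T$, $1/\delta$ and $C$. Algorithm QuFUR$(\alpha)$ (parameter $\alpha>0$): initialize $M\leftarrow C^{-2}I_d$ and queried set $\mathcal{Q}\leftarrow\emptyset$. For each $t$: let $M_t$ be the current $M$; set $\hat\theta_t=M_t^{-1}\sum_{s\in\mathcal{Q}}x_s y_s$; predict $\hat y_t=\mathrm{clip}(\langle\hat\theta_t,x_t\rangle)$; set $\Delta_t=\tilde\eta^2\min\{1,\|x_t\|^2_{M_t^{-1}}\}$; independently set $q_t=1$ with probability $\min\{1,\alpha\Delta_t\}$ and $q_t=0$ otherwise; if $q_t=1$, observe $y_t$, update $M\leftarrow M+x_tx_t^\top$ and $\mathcal{Q}\leftarrow\mathcal{Q}\cup\{t\}$. *)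

(* Defs.v *)
From HB Require Import structures.
From mathcomp Require Import all_boot all_order all_algebra.
From mathcomp Require Import all_classical all_reals all_analysis.
Set Implicit Arguments. Unset Strict Implicit. Unset Printing Implicit Defensive.
Import Order.TTheory GRing.Theory Num.Theory.
Local Open Scope ring_scope.
Local Open Scope classical_set_scope.

Definition clip {R : realType} (z : R) : R := Num.min 1 (Num.max (-1) z).

Definition etat {R : realType} (eta : R) : R := Num.max 1 eta.

Definition inner {R : realType} {d : nat} (a b : 'rV[R]_d) : R := (a *m b^T) 0 0.
Definition norm2 {R : realType} {d : nat} (a : 'rV[R]_d) : R := Num.sqrt (inner a a).

(* The algorithm QuFUR(alpha), run deterministically on a realization:
   xiv t = realized noise xi_t, uv t = realized internal uniform coin U_t.
   Rounds t = 1..T of the paper are indexed 0..T-1 here.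
   Query rule: q_t = 1 iff U_t < min{1, alpha Delta_t}, i.e. with probability
   min{1, alpha Delta_t} when U_t is uniform on [0,1] and independent. *)
Section QuFUR.
Variables (R : realType) (d : nat) (C eta alpha : R).
Variables (theta : 'rV[R]_d) (x : nat -> 'rV[R]_d) (xiv uv : nat -> R).

Definition label (t : nat) : R := inner theta (x t) + xiv t.

Definition Delta (t : nat) (M : 'M[R]_d) : R :=
  etat eta ^+ 2 * Num.min 1 (inner (x t *m invmx M) (x t)).

Definition query (t : nat) (M : 'M[R]_d) : bool :=
  uv t < Num.min 1 (alpha * Delta t M).

(* state before round t: (M_t, sum_{s in Q} y_s x_s) *)
Fixpoint state (t : nat) : 'M[R]_d * 'rV[R]_d :=
  match t with
  | 0 => ((C ^- 2)%:M, 0)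
  | t'.+1 =>
      let MS := state t' in
      if query t' MS.1
      then (MS.1 + (x t')^T *m x t', MS.2 + label t' *: x t')
      else MS
  end.

Definition theta_hat (t : nat) : 'cV[R]_d := invmx (state t).1 *m (state t).2^T.

Definition prediction (t : nat) : R := clip ((x t *m theta_hat t) 0 0).

Definition q (t : nat) : bool := query t (state t).1.

Definition query_complexity (T : nat) : R := \sum_(t < T) (q t)%:R.

Definition regret (T : nat) : R :=
  \sum_(t < T) (prediction t - inner theta (x t)) ^+ 2.
End QuFUR.

Definition mutually_independent {dT : measure_display} {Omega : measurableType dT}
  {R : realType} (P : probability Omega R) {I : eqType} (S : set I)
  (X : I -> Omega -> R) : Prop :=
  forall (J : seq I) (B : I -> set R),
    uniq J -> (forall i, i \in J -> S i) -> (forall i, measurable (B i)) ->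
    P (\bigcap_(i in [set` J]) (X i @^-1` B i)) =
    (\prod_(i <- J) P (X i @^-1` B i))%E.

Definition zero_mean_subgaussian {dT : measure_display} {Omega : measurableType dT}
  {R : realType} (P : probability Omega R) (X : Omega -> R) (eta : R) : Prop :=
  measurable_fun setT X /\ P.-integrable setT (EFin \o X) /\
  ('E_P[X] = 0)%E /\
  forall lam : R, ('E_P[fun w => expR (lam * X w)] <= (expR (lam ^+ 2 * eta ^+ 2 / 2))%:E)%E.

Definition uniform01 {dT : measure_display} {Omega : measurableType dT}
  {R : realType} (P : probability Omega R) (X : Omega -> R) : Prop :=
  measurable_fun setT X /\
  forall r : R, 0 <= r <= 1 -> P [set w | X w < r] = r%:E.

Definition logfactor {R : realType} (T : nat) (delta C : R) : R :=
  1 + ln (1 + T%:R) + ln (1 + delta^-1) + ln (1 + C).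

(* Main.v *)
Require Import Defs.
From HB Require Import structures.
From mathcomp Require Import all_boot all_order all_algebra.
From mathcomp Require Import all_classical all_reals all_analysis measurable_realfun.
From mathcomp Require Import ring lra.
Import Order.TTheory GRing.Theory Num.Theory.
Local Open Scope ring_scope.
Local Open Scope classical_set_scope.

(** The query decisions depend on the coins only, so a run is described by its
    finite history of query bits: by independence each history has an explicit
    product probability, and given the history the design is fixed and the
    noise is still independent sub-Gaussian. The following nonnegative
    quantities all have expectation at most 1: for each group of rounds, the
    exponential of the sum of p z / 2 - q z, where p is the query probability,
    q the query bit and z the leverage capped at 1; the exponential of the sum
    of q / 2 - p; and, for each round, the exponential of plus or minus the
    normalised prediction noise, less 1 / 2. One application of Markov's
    inequality to their sum bounds all of them by exp (2 L).

    The rest is deterministic. The elliptical potential lemma inside the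
    subspace of a group bounds its sum of q z by O(d_u L), hence also its sum
    of p z. Since p = min (1, alpha Delta), the Cauchy-Schwarz inequality turns
    this into the bounds on the sums of p and of Delta, and the squared
    prediction error of a round is O(L^2 Delta). *)

(** * Inner products of row vectors *)

Section InnerProduct.
Context {R : realType}.

Lemma innerE {d} (a b : 'rV[R]_d) : inner a b = \sum_j a 0 j * b 0 j.
Proof. by rewrite /inner mxE; apply: eq_bigr => j _; rewrite mxE. Qed.

Lemma innerC {d} (a b : 'rV[R]_d) : inner a b = inner b a.
Proof. by rewrite !innerE; apply: eq_bigr => j _; rewrite mulrC. Qed.

Lemma innerDl {d} (a b c : 'rV[R]_d) : inner (a + b) c = inner a c + inner b c.
Proof. by rewrite /inner mulmxDl mxE. Qed.

Lemma innerZl {d} k (a b : 'rV[R]_d) : inner (k *: a) b = k * inner a b.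
Proof. by rewrite /inner -scalemxAl mxE. Qed.

Lemma innerZr {d} k (a b : 'rV[R]_d) : inner a (k *: b) = k * inner a b.
Proof. by rewrite innerC innerZl innerC. Qed.

Lemma innerNl {d} (a b : 'rV[R]_d) : inner (- a) b = - inner a b.
Proof. by rewrite -scaleN1r innerZl mulN1r. Qed.

Lemma innerDr {d} (a b c : 'rV[R]_d) : inner a (b + c) = inner a b + inner a c.
Proof. by rewrite innerC innerDl !(innerC a). Qed.

Lemma innerNr {d} (a b : 'rV[R]_d) : inner a (- b) = - inner a b.
Proof. by rewrite innerC innerNl innerC. Qed.

Lemma inner0l {d} (a : 'rV[R]_d) : inner 0 a = 0.
Proof. by rewrite /inner mul0mx mxE. Qed.

Lemma inner_adj {n d} (a : 'rV[R]_n) (A : 'M[R]_(n, d)) (b : 'rV[R]_d) :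
  inner (a *m A) b = inner a (b *m A^T).
Proof. by rewrite /inner trmx_mul trmxK mulmxA. Qed.

Lemma inner_ge0 {d} (a : 'rV[R]_d) : 0 <= inner a a.
Proof. by rewrite innerE sumr_ge0// => j _; rewrite -expr2 sqr_ge0. Qed.

Lemma inner_eq0 {d} (a : 'rV[R]_d) : (inner a a == 0) = (a == 0).
Proof.
apply/idP/eqP => [|->]; last by rewrite inner0l.
rewrite innerE psumr_eq0; last by move=> j _; rewrite -expr2 sqr_ge0.
move=> /allP a0; apply/rowP => j; rewrite mxE.
by have := a0 j (mem_index_enum _); rewrite /= mulf_eq0 orbb => /eqP.
Qed.

Lemma inner_gt0 {d} (a : 'rV[R]_d) : a != 0 -> 0 < inner a a.
Proof. by move=> a0; rewrite lt_def inner_eq0 a0 inner_ge0. Qed.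

Lemma norm2_le {d} (a : 'rV[R]_d) c : 0 <= c ->
  norm2 a <= c -> inner a a <= c ^+ 2.
Proof.
move=> c0; rewrite /norm2 => ac.
by rewrite -(sqr_sqrtr (inner_ge0 a)) ler_sqr ?nnegrE ?sqrtr_ge0.
Qed.

Lemma mul_rank1 {d} (z v : 'rV[R]_d) : z *m (v^T *m v) = inner z v *: v.
Proof. by rewrite mulmxA [z *m _]mx11_scalar mul_scalar_mx. Qed.

End InnerProduct.

(** * Positive definite matrices and their rank-one updates *)

Section PositiveDefinite.
Context {R : realType}.

Definition posdef {n} (A : 'M[R]_n) :=
  A^T = A /\ forall z : 'rV[R]_n, z != 0 -> 0 < inner (z *m A) z.

Lemma posdef_scalar {n} (c : R) : 0 < c -> posdef (c%:M : 'M[R]_n).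
Proof.
move=> c0; split; first by rewrite tr_scalar_mx.
by move=> z z0; rewrite mul_mx_scalar innerZl mulr_gt0// inner_gt0.
Qed.

Lemma inner_add_rank1 {n} (A : 'M[R]_n) (v z : 'rV[R]_n) :
  inner (z *m (A + v^T *m v)) z = inner (z *m A) z + inner z v ^+ 2.
Proof. by rewrite mulmxDr innerDl mul_rank1 innerZl (innerC v) expr2. Qed.

Lemma posdef_add_rank1 {n} (A : 'M[R]_n) (v : 'rV[R]_n) :
  posdef A -> posdef (A + v^T *m v).
Proof.
move=> [sA pA]; split; first by rewrite linearD/= sA trmx_mul trmxK.
by move=> z z0; rewrite inner_add_rank1 ltr_wpDr ?sqr_ge0 ?pA.
Qed.

Lemma posdef_ge0 {n} (A : 'M[R]_n) (z : 'rV[R]_n) :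
  posdef A -> 0 <= inner (z *m A) z.
Proof.
move=> [_ pA]; have [->|/pA/ltW//] := eqVneq z 0.
by rewrite mul0mx inner0l.
Qed.

Lemma posdef_unit {n} (A : 'M[R]_n) : posdef A -> A \in unitmx.
Proof.
move=> [_ pA]; rewrite -row_free_unit; apply: inj_row_free => v vA.
by apply: contraTeq isT => /pA; rewrite vA inner0l ltxx.
Qed.

(* With equality at z = x A^-1: the inverse quadratic form is the Legendre
   transform of the direct one. *)
Lemma posdef_inv_variational {n} (A : 'M[R]_n) (x z : 'rV[R]_n) : posdef A ->
  2 * inner x z - inner (z *m A) z <= inner (x *m invmx A) x.
Proof.
move=> pA; have [sA _] := pA; have uA := posdef_unit _ pA.
have := posdef_ge0 _ (x *m invmx A - z) pA.
rewrite mulmxBl mulmxKV// !innerDl !innerNl !innerDr !innerNr.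
have -> : inner (z *m A) (x *m invmx A) = inner x z.
  by rewrite inner_adj sA mulmxKV// innerC.
by rewrite (innerC x (_ *m _)); lra.
Qed.

Lemma posdef_inv_ge0 {n} (A : 'M[R]_n) (x : 'rV[R]_n) : posdef A ->
  0 <= inner (x *m invmx A) x.
Proof.
move=> pA; have := posdef_inv_variational A x 0 pA.
by rewrite innerC inner0l mul0mx inner0l; lra.
Qed.

(** Matrix determinant lemma. The bordered matrix [B] is made block triangular by column operations
    in [e1] and by row operations in [e2]; comparing the two determinants gives the formula. *)
Lemma det_add_rank1 {n} (A : 'M[R]_n) (v : 'rV[R]_n) : A \in unitmx ->
  \det (A + v^T *m v) = \det A * (1 + inner (v *m invmx A) v).
Proof.
move=> uA.
pose B : 'M[R]_(n + 1) := block_mx A (- v^T) v 1%:M.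
have e1 : B *m block_mx 1%:M 0 (- v) 1%:M
        = block_mx (A + v^T *m v) (- v^T) 0 1%:M.
  rewrite mulmx_block !mulmx1 !mulmx0 !mul1mx mulmxN mulNmx opprK subrr.
  by rewrite !add0r.
have e2 : block_mx 1%:M 0 (- (v *m invmx A)) 1%:M *m B
        = block_mx A (- v^T) 0 (1%:M + v *m invmx A *m v^T).
  rewrite mulmx_block !mul1mx !mul0mx !mulNmx mulmxKV// !addr0 addNr.
  by rewrite mulmxN opprK addrC.
have dB : \det B = \det (A + v^T *m v).
  have := congr1 determinant e1.
  by rewrite det_mulmx det_lblock det_ublock !det1 !mulr1.
have := congr1 determinant e2.
rewrite det_mulmx det_lblock det_ublock !det1 !mul1r dB => ->.
by rewrite det_mx11 /inner !mxE eqxx.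
Qed.

(** The rows of [X] are added one by one, each multiplying the determinant by a factor at least
    1. *)
Lemma posdef_det_add_gram {n r} (A : 'M[R]_n) (X : 'M[R]_(r, n)) :
  posdef A -> 0 < \det A ->
  [/\ posdef (A + X^T *m X) & \det A <= \det (A + X^T *m X)].
Proof.
elim: r X A => [|r IH] X A pA dA.
  by rewrite [X]flatmx0 mulmx0 addr0; split.
set v := usubmx (X : 'M[R]_(1 + r, n)).
have -> : X^T *m X = v^T *m v + (dsubmx (X : 'M[R]_(1 + r, n)))^T *m dsubmx (X : 'M[R]_(1 + r, n)).
  by rewrite -mul_row_col -tr_col_mx vsubmxK.
rewrite addrA.
have dv : \det A <= \det (A + v^T *m v).
  rewrite det_add_rank1 ?posdef_unit//; apply: ler_peMr; first exact: ltW.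
  by rewrite lerDl posdef_inv_ge0.
have [pX dX] := IH (dsubmx (X : 'M[R]_(1 + r, n))) _ (posdef_add_rank1 _ v pA) (lt_le_trans dA dv).
by split=> //; apply: le_trans dX.
Qed.

End PositiveDefinite.

(** * Orthonormal families and projections *)

Section Orthonormal.
Context {R : realType}.

(** Gram-Schmidt on the rows of [V]; a row already in the span of the family is skipped, hence only
    [k <= n]. *)
Lemma exists_orthonormal_rows {d n} (V : 'M[R]_(n, d)) :
  exists k (Q : 'M[R]_(k, d)), [/\ (k <= n)%N, Q *m Q^T = 1%:M & (V <= Q)%MS].
Proof.
elim: n V => [|n IH] V.
  by exists 0%N, V; split => //; rewrite ?flatmx0 // [RHS]flatmx0.
have [k [Q [kn QQ VQ]]] := IH (dsubmx (V : 'M[R]_(1 + n, d))).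
set v := usubmx (V : 'M[R]_(1 + n, d)).
have Vsub p (W : 'M[R]_(p, d)) :
    (V <= W)%MS = (v <= W)%MS && (dsubmx (V : 'M[R]_(1 + n, d)) <= W)%MS.
  by rewrite -col_mx_sub vsubmxK.
(* The component of [v] orthogonal to the family built so far. *)
pose r := v - v *m Q^T *m Q.
have rQ : r *m Q^T = 0 by rewrite mulmxBl -[_ *m Q *m _]mulmxA QQ mulmx1 subrr.
have vE : v = v *m Q^T *m Q + r by rewrite /r addrC subrK.
have [r0|r0] := eqVneq r 0.
  exists k, Q; split => //; first exact: leqW.
  rewrite Vsub VQ andbT.
  by rewrite vE r0 addr0 submxMl.
have nr := inner_gt0 _ r0.
pose e := (Num.sqrt (inner r r))^-1 *: r.
exists (1 + k)%N, (col_mx e Q); split; first by rewrite ltnS.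
  rewrite tr_col_mx mul_col_row QQ.
  have eQ : e *m Q^T = 0 by rewrite -scalemxAl rQ scaler0.
  have -> : Q *m e^T = 0 by rewrite -[Q]trmxK -trmx_mul eQ trmx0.
  rewrite eQ [e *m _]mx11_scalar -/(inner e e) innerZl innerZr mulrA -expr2.
  rewrite exprVn sqr_sqrtr ?ltW// mulVf ?gt_eqF//.
  by rewrite -scalar_mx_block.
have := submx_refl (col_mx e Q); rewrite col_mx_sub => /andP[eS QS].
rewrite Vsub (submx_trans VQ QS) andbT.
rewrite vE addmx_sub ?(submx_trans (submxMl _ _) QS)//.
apply: submx_trans eS.
have -> : r = Num.sqrt (inner r r) *: e.
  by rewrite scalerA divff ?scale1r// gt_eqF ?sqrtr_gt0.
exact: scalemx_sub.
Qed.

(** Expand the squared norm of [z] minus its projection on the rows of [Q]. *)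
Lemma bessel_inequality {d k} (Q : 'M[R]_(k, d)) (z : 'rV[R]_d) :
  Q *m Q^T = 1%:M -> inner (z *m Q^T) (z *m Q^T) <= inner z z.
Proof.
move=> QQ; have := inner_ge0 (z - z *m Q^T *m Q).
rewrite !innerDl !innerNl !innerDr !innerNr.
have -> : inner (z *m Q^T *m Q) (z *m Q^T *m Q) = inner (z *m Q^T) (z *m Q^T).
  by rewrite inner_adj -[_ *m Q *m _]mulmxA QQ mulmx1.
have -> : inner (z *m Q^T *m Q) z = inner (z *m Q^T) (z *m Q^T) by rewrite inner_adj.
have -> : inner z (z *m Q^T *m Q) = inner (z *m Q^T) (z *m Q^T).
  by rewrite innerC inner_adj.
lra.
Qed.

Lemma submx_orthonormal {d k} (Q : 'M[R]_(k, d)) (x : 'rV[R]_d) :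
  Q *m Q^T = 1%:M -> (x <= Q)%MS -> x = x *m Q^T *m Q.
Proof.
by move=> QQ /submxP[y ->]; rewrite -[_ *m Q *m Q^T]mulmxA QQ mulmx1.
Qed.

(* [1 - y^T y] is the square of [1 - c y^T y] for c = 1 / (1 + sqrt (1 - |y|^2)). *)
Lemma id_sub_rank1_gram {k} (y : 'rV[R]_k) : inner y y <= 1 ->
  exists B : 'M[R]_k, B^T *m B = 1%:M - y^T *m y.
Proof.
move=> y1; pose r := inner y y; pose s := Num.sqrt (1 - r); pose c := (1 + s)^-1.
have s0 : 0 <= s by exact: sqrtr_ge0.
have s2 : s ^+ 2 = 1 - r by rewrite sqr_sqrtr// subr_ge0.
have c0 : 1 + s != 0 by lra.
exists (1%:M - c *: (y^T *m y)).
have -> : (1%:M - c *: (y^T *m y))^T = 1%:M - c *: (y^T *m y).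
  by rewrite linearB linearZ/= trmx1 trmx_mul trmxK.
have yy : (y^T *m y) *m (y^T *m y) = r *: (y^T *m y).
  by rewrite -mulmxA mul_rank1 -scalemxAr.
rewrite mulmxBl mul1mx mulmxBr mulmx1 -scalemxAl -scalemxAr yy !scalerA.
have key : c + c - c * (c * r) = 1.
  have -> : r = 1 - s ^+ 2 by rewrite s2; lra.
  by rewrite /c; field.
move: (y^T *m y) => Y; apply/matrixP => i j; rewrite !mxE.
rewrite -[in RHS](mul1r (Y i j)) -key; ring.
Qed.

End Orthonormal.

(** * Sums along a query history *)

Section PrefixSums.
Context {R : realType}.

(* Query histories are lists of bits, latest round first, so that the rounds
   of a history h are its tails: round number [size h'] has past h'. *)
Fixpoint hsum (F : seq bool -> bool -> R) (h : seq bool) : R :=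
  if h is b :: h' then hsum F h' + F h' b else 0.

Lemma ler_hsum F G h : (forall h' b, (size h' < size h)%N -> F h' b <= G h' b) ->
  hsum F h <= hsum G h.
Proof.
elim: h => //= b h IH FG; rewrite lerD ?FG// IH// => h' c hh.
by rewrite FG// ltnS ltnW.
Qed.

Lemma hsumD F G h : hsum (fun h' b => F h' b + G h' b) h = hsum F h + hsum G h.
Proof. by elim: h => /= [|b h ->]; [rewrite addr0|rewrite addrACA]. Qed.

Lemma hsumZ c F h : hsum (fun h' b => c * F h' b) h = c * hsum F h.
Proof. by elim: h => /= [|b h ->]; rewrite ?mulr0 ?mulrDr. Qed.

End PrefixSums.

(** * The elliptical potential inside a subspace *)

Section Potential.
Context {R : realType} {d : nat}.
Variables (C : R) (x : nat -> 'rV[R]_d).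

Fixpoint design (h : seq bool) : 'M[R]_d :=
  match h with
  | [::] => (C ^- 2)%:M
  | b :: h' => if b then design h' + (x (size h'))^T *m x (size h') else design h'
  end.

Definition leverage (h : seq bool) : R :=
  inner (x (size h) *m invmx (design h)) (x (size h)).

Hypothesis C0 : 0 < C.

Lemma posdef_design h : posdef (design h).
Proof.
elim: h => /= [|[] h IH //]; last exact: posdef_add_rank1.
by apply: posdef_scalar; rewrite invr_gt0 exprn_gt0.
Qed.

Lemma leverage_ge0 h : 0 <= leverage h.
Proof. exact: posdef_inv_ge0 (posdef_design h). Qed.

Lemma inner_design h (z : 'rV[R]_d) : inner (z *m design h) z =
  C ^- 2 * inner z z + hsum (fun h' b => b%:R * inner z (x (size h')) ^+ 2) h.
Proof.
elim: h => /= [|[] h IH]; first by rewrite mul_mx_scalar innerZl addr0.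
  by rewrite inner_add_rank1 IH mul1r addrA.
by rewrite IH mul0r addr0.
Qed.

Variables (k : nat) (Q : 'M[R]_(k, d)) (G : pred nat).
Hypothesis QQ : Q *m Q^T = 1%:M.

Let y t := x t *m Q^T.

(** The design of the queried rounds of the group [G] alone, in the coordinates given by [Q] and
    multiplied by [C ^+ 2] so that it starts at the identity. Its size is the dimension of the
    subspace instead of [d]. *)
Fixpoint subdesign (h : seq bool) : 'M[R]_k :=
  match h with
  | [::] => 1%:M
  | b :: h' => if b && G (size h')
               then subdesign h' + (C *: y (size h'))^T *m (C *: y (size h'))
               else subdesign h'
  end.

Lemma posdef_subdesign h : posdef (subdesign h).
Proof.
elim: h => /= [|b h IH]; first by apply: posdef_scalar.
by case: ifP => // _; exact: posdef_add_rank1.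
Qed.

Lemma inner_subdesign h (w : 'rV[R]_k) : inner (w *m subdesign h) w =
  inner w w + hsum (fun h' b => (b && G (size h'))%:R *
                       (C ^+ 2 * inner w (y (size h')) ^+ 2)) h.
Proof.
elim: h => /= [|b h IH]; first by rewrite mulmx1 addr0.
case: ifP => _; last by rewrite IH mul0r addr0.
by rewrite inner_add_rank1 IH mul1r addrA innerZr exprMn.
Qed.

(** The vector [z] attains the variational formula for the full design, and [C^-1 *: w] is tested in
    the one for the subdesign. The linear terms agree, and the quadratic term can only decrease: the
    norm by Bessel, the sum because the rounds outside [G] are left out. *)
Lemma leverage_le_subdesign h :
  (forall t, (t <= size h)%N -> G t -> (x t <= Q)%MS) -> G (size h) ->
  leverage h <= inner (C *: y (size h) *m invmx (subdesign h)) (C *: y (size h)).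
Proof.
move=> xQ Gh; pose t := size h; pose z := x t *m invmx (design h).
have pD := posdef_design h; have pS := posdef_subdesign h.
have zD : z *m design h = x t by rewrite mulmxKV// posdef_unit.
have levE : leverage h = 2 * inner (x t) z - inner (z *m design h) z.
  by rewrite zD /leverage -/t -/z (innerC z); ring.
pose w := z *m Q^T.
have xz : forall s, (s <= size h)%N -> G s -> inner z (x s) = inner w (y s).
  move=> s sh Gs; rewrite {1}(submx_orthonormal _ _ QQ (xQ s sh Gs)).
  by rewrite innerC inner_adj innerC.
apply: le_trans (posdef_inv_variational _ _ (C^-1 *: w) pS).
rewrite levE inner_design inner_subdesign.
have e1 : inner (x t) z = inner (y t) w by rewrite innerC xz// innerC.
have e2 : inner (C *: y t) (C^-1 *: w) = inner (y t) w.
  by rewrite innerZl innerZr mulrA mulfV ?mul1r ?gt_eqF.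
have e3 : inner (C^-1 *: w) (C^-1 *: w) = C ^- 2 * inner w w.
  by rewrite innerZl innerZr mulrA -expr2 exprVn.
rewrite e1 e2 e3.
have bes : inner w w <= inner z z by exact: bessel_inequality.
have sums : hsum (fun h' b => (b && G (size h'))%:R *
                    (C ^+ 2 * inner (C^-1 *: w) (y (size h')) ^+ 2)) h
         <= hsum (fun h' b => b%:R * inner z (x (size h')) ^+ 2) h.
  apply: ler_hsum => h' b hh; case: b; rewrite /= ?mul0r//.
  have [Gh'|_] := boolP (G (size h')); last by rewrite mul0r mul1r sqr_ge0.
  rewrite (xz (size h'))//; last exact: ltnW.
  rewrite innerZl exprMn exprVn !mul1r mulrA mulfV ?mul1r//.
  by rewrite gt_eqF ?exprn_gt0.
have C2 : 0 < C ^- 2 by rewrite invr_gt0 exprn_gt0.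
have : C ^- 2 * inner w w <= C ^- 2 * inner z z by rewrite ler_wpM2l// ltW.
by lra.
Qed.

(** The bound ln y <= y - 1 at y = 1 / (1 + g) gives ln (1 + g) >= g / (1 + g), and twice the latter
    dominates min (1, g), separately for g >= 1 and g < 1. *)
Lemma min1_le_ln (g : R) : 0 <= g -> Num.min 1 g <= 2 * ln (1 + g).
Proof.
move=> g0; have g1 : 0 < 1 + g by lra.
have lnV : ln (1 + g) = - ln (1 + g)^-1 by rewrite lnV ?opprK// posrE.
have i0 : 0 < (1 + g)^-1 by rewrite invr_gt0.
have iE : (1 + g)^-1 * (1 + g) = 1 by rewrite mulVf ?gt_eqF.
have le1 : ln (1 + g)^-1 <= (1 + g)^-1 - 1.
  by rewrite -{1}(subrKC 1 (1 + g)^-1); apply: le_ln1Dx; lra.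
rewrite lnV; suff : Num.min 1 g <= 2 * (1 - (1 + g)^-1) by lra.
move: ((1 + g)^-1) i0 iE => i i0 iE; have [gle|gle] := leP 1 g; first by nra.
have ig : 0 < i * (1 - g) by rewrite mulr_gt0//; lra.
have i2 : 0 <= 2 * i - 1 by lra.
by have := mulr_ge0 g0 i2; lra.
Qed.

Lemma det_subdesign_gt0 h : 0 < \det (subdesign h).
Proof.
elim: h => /= [|b h IH]; first by rewrite det1.
case: ifP => // _.
have [_] := posdef_det_add_gram (subdesign h) (C *: y (size h)) (posdef_subdesign h) IH.
exact: lt_le_trans.
Qed.

(** Every counted round multiplies the determinant by 1 + g, where g dominates the leverage, so the
    logarithms telescope. *)
Lemma hsum_leverage_le_det h :
  (forall t, (t < size h)%N -> G t -> (x t <= Q)%MS) ->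
  hsum (fun h' b => (b && G (size h'))%:R * Num.min 1 (leverage h')) h
  <= 2 * ln (\det (subdesign h)).
Proof.
elim: h => /= [|b h IH] xQ; first by rewrite det1 ln1 mulr0.
have IH' := IH (fun t th => xQ t (ltnW th)).
case: ifP => [/andP[_ Gh]|_]; last by rewrite mul0r addr0.
rewrite det_add_rank1; last exact: posdef_unit (posdef_subdesign h).
set g := inner _ _; have g0 : 0 <= g by exact: posdef_inv_ge0 (posdef_subdesign h).
rewrite lnM ?posrE ?det_subdesign_gt0//; last by lra.
rewrite mulrDr mul1r lerD//; apply: le_trans (min1_le_ln _ g0).
have := leverage_le_subdesign h xQ Gh; rewrite -/g => lg.
by rewrite le_min !ge_min lexx lg orbT.
Qed.

(** The subdesign is completed to a scalar matrix by adding a Gram matrix, which can only increase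
    the determinant. *)
Lemma det_subdesign_le h :
  (forall t, (t < size h)%N -> G t -> inner (x t) (x t) <= 1) ->
  \det (subdesign h) <= (1 + C ^+ 2 * (size h)%:R) ^+ k.
Proof.
move=> x1.
suff [r [X SX]] : exists r (X : 'M[R]_(r, k)),
    subdesign h + X^T *m X = (1 + C ^+ 2 * (size h)%:R)%:M.
  have [_] := posdef_det_add_gram _ X (posdef_subdesign h) (det_subdesign_gt0 h).
  by rewrite SX det_scalar.
elim: h x1 => /= [|b h IH] x1.
  by exists 0%N, 0; rewrite mulmx0 mulr0 !addr0.
have [r [X SX]] := IH (fun t th => x1 t (ltnW th)).
(* A round contributes [C ^+ 2] times [v^T *m v] to the subdesign, and the new rows [C *: B] of the
   complement raise this to [C ^+ 2] times the identity. *)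
have stepE (B : 'M[R]_k) (v : 'rV[R]_k) : B^T *m B = 1%:M - v^T *m v ->
    subdesign h + (C *: v)^T *m (C *: v) + (col_mx X (C *: B))^T *m col_mx X (C *: B)
    = (1 + C ^+ 2 * (size h).+1%:R)%:M.
  have CC n (M : 'M[R]_(n, k)) : (C *: M)^T *m (C *: M) = C ^+ 2 *: (M^T *m M).
    by rewrite [(C *: M)^T]linearZ/= -scalemxAl -scalemxAr scalerA expr2.
  move=> BB; rewrite tr_col_mx mul_row_col !CC BB.
  rewrite addrACA SX -scalerDr addrC subrKC.
  apply/matrixP => i j; rewrite !mxE -natr1 mulrDr mulr1 addrA mulrnDl addrC.
  by case: (i == j); rewrite /= ?mulr1n ?mulr0n ?mulr1 ?mulr0.
case: ifP => [/andP[_ Gh]|_].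
  have [|B BB] := id_sub_rank1_gram (y (size h)).
    by apply: le_trans (bessel_inequality _ _ QQ) _; exact: x1.
  by exists (r + k)%N, (col_mx X (C *: B)); rewrite stepE.
(* A round that is not counted has [v = 0], and the complement supplies the whole increment. *)
exists (r + k)%N, (col_mx X (C *: 1%:M)).
rewrite -(stepE 1%:M 0); last by rewrite trmx1 mulmx1 mulmx0 subr0.
by rewrite scaler0 mulmx0 addr0.
Qed.

End Potential.

(** The previous bounds are applied to an orthonormal family of at most [n] rows whose span contains
    the rows of [V]. *)
Lemma elliptical_potential {R : realType} {d n : nat} (C : R) (x : nat -> 'rV[R]_d)
    (V : 'M[R]_(n, d)) (G : pred nat) h :
  0 < C ->
  (forall t, (t < size h)%N -> G t -> (x t <= V)%MS) ->
  (forall t, (t < size h)%N -> norm2 (x t) <= 1) ->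
  hsum (fun h' b => (b && G (size h'))%:R * Num.min 1 (leverage C x h')) h
  <= 4 * n%:R * (ln (1 + (size h)%:R) + ln (1 + C)).
Proof.
move=> C0 xV x1; have [k [Q [kn QQ VQ]]] := exists_orthonormal_rows V.
have T0 : 0 <= (size h)%:R :> R by [].
have CT : 0 <= C ^+ 2 * (size h)%:R by rewrite mulr_ge0 ?sqr_ge0.
have pos1 : 0 < 1 + C ^+ 2 * (size h)%:R by lra.
apply: le_trans (hsum_leverage_le_det C x C0 k Q G QQ h _) _.
  by move=> t th Gt; apply: submx_trans (xV t th Gt) VQ.
apply: (@le_trans _ _ (2 * (k%:R * ln (1 + C ^+ 2 * (size h)%:R)))).
  rewrite ler_pM2l// mulr_natl -lnXn// ler_ln ?posrE ?det_subdesign_gt0 ?exprn_gt0//.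
  apply: det_subdesign_le => // t th _.
  by have := norm2_le (x t) _ ler01 (x1 t th); rewrite expr1n.
(* The product of 1 + T and (1 + C)^2 dominates 1 + C^2 T, with T the length of [h]. *)
have l1 : ln (1 + C ^+ 2 * (size h)%:R) <= ln (1 + (size h)%:R) + (ln (1 + C) + ln (1 + C)).
  rewrite -!lnM ?posrE ?mulr_gt0//; try by lra.
  rewrite ler_ln ?posrE//; last by rewrite !mulr_gt0; lra.
  by have := C0; nra.
have l0 : 0 <= ln (1 + C ^+ 2 * (size h)%:R) by rewrite ln_ge0//; lra.
have lT : 0 <= ln (1 + (size h)%:R : R) by rewrite ln_ge0//; lra.
have kn' : k%:R <= n%:R :> R by rewrite ler_nat.
have k0 : 0 <= k%:R :> R by [].
apply: (@le_trans _ _ (2 * (n%:R * ln (1 + C ^+ 2 * (size h)%:R)))).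
  by rewrite ler_pM2l// ler_wpM2r.
have n0 : 0 <= n%:R :> R by [].
by nra.
Qed.

(** * Expectations of products of independent variables *)

Section IndependentProducts.
Context {dT : measure_display} {Omega : measurableType dT} {R : realType}.
Variable P : probability Omega R.
Import HBNNSimple.

Lemma ge0_integral_EFinZl (k : R) (f : Omega -> R) : 0 <= k ->
  measurable_fun setT f -> (forall w, 0 <= f w) ->
  (\int[P]_w (k * f w)%:E = k%:E * \int[P]_w (f w)%:E)%E.
Proof.
move=> k0 mf f0; under eq_integral do rewrite EFinM.
rewrite ge0_integralZl_EFin//; last exact/measurable_EFinP.
by move=> w _; rewrite lee_fin.
Qed.

Lemma ge0_integral_EFin_sum (I : Type) (s : seq I) (f : I -> Omega -> R) :
  (forall i, measurable_fun setT (f i)) -> (forall i w, 0 <= f i w) ->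
  (\int[P]_w (\sum_(i <- s) f i w)%:E = \sum_(i <- s) \int[P]_w (f i w)%:E)%E.
Proof.
move=> mf f0; under eq_integral do rewrite -sumEFin.
rewrite ge0_integral_sum//; last by move=> i w _; rewrite lee_fin.
by move=> i; exact/measurable_EFinP.
Qed.

Lemma ge0_le_integral_EFin (f g : Omega -> R) :
  measurable_fun setT f -> measurable_fun setT g ->
  (forall w, 0 <= f w) -> (forall w, f w <= g w) ->
  (\int[P]_w (f w)%:E <= \int[P]_w (g w)%:E)%E.
Proof.
move=> mf mg f0 fg; apply: ge0_le_integral => //.
- by move=> w _; rewrite lee_fin.
- exact/measurable_EFinP.
- exact/measurable_EFinP.
- by move=> w _; rewrite lee_fin.
Qed.

Lemma indic_comp (X : Omega -> R) (B : set R) w : \1_B (X w) = \1_(X @^-1` B) w :> R.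
Proof. by rewrite !indicE; congr (_%:R); apply/idP/idP; rewrite !inE. Qed.

Lemma measurable_indic_comp (X : Omega -> R) (B : set R) :
  measurable_fun setT X -> measurable B ->
  measurable_fun setT (fun w => \1_B (X w) : R).
Proof.
move=> mX mB; rewrite (_ : (fun _ => _) = \1_(X @^-1` B)).
  by apply: measurable_indic; rewrite -[X in measurable X]setTI; exact: mX.
by apply/funext => w; exact: indic_comp.
Qed.

Section IndicatorToFunction.
Variables (X Y : Omega -> R) (c : R).
Hypotheses (mX : measurable_fun setT X) (mY : measurable_fun setT Y).
Hypotheses (Y0 : forall w, 0 <= Y w) (c0 : 0 <= c).
Hypothesis YB : forall B : set R, measurable B ->
  (\int[P]_w (Y w * \1_B (X w))%:E <= c%:E * P (X @^-1` B))%E.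

(** By linearity over the level sets of [g], on each of which [YB] applies. *)
Lemma integral_mul_nnsfun_le (g : {nnsfun R >-> R}) :
  (\int[P]_w (Y w * g (X w))%:E <= c%:E * \int[P]_w (g (X w))%:E)%E.
Proof.
have /= gE := fimfunEord g; set s := finmap.enum_fset _ in gE.
have mg (i : nat) : measurable (g @^-1` [set s`_i]).
  exact: (measurable_sfunP g (measurable_set1 _)).
have mI i : measurable_fun setT (fun w => \1_(g @^-1` [set s`_i]) (X w) : R).
  exact: measurable_indic_comp.
(* Beyond the list of values, [nth] returns its default 0. *)
have s0 (i : nat) : 0 <= s`_i.
  have [si|si] := leqP (size s) i; first by rewrite nth_default.
  have : s`_i \in s by exact: mem_nth.
  by rewrite /s in_fset_set// inE => -[z _ <-].
have I0 i w : 0 <= \1_(g @^-1` [set s`_i]) (X w) :> R by rewrite indicE.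
have mYI i : measurable_fun setT (fun w => Y w * \1_(g @^-1` [set s`_i]) (X w)).
  exact: measurable_funM.
have YI0 i w : 0 <= Y w * \1_(g @^-1` [set s`_i]) (X w) by exact: mulr_ge0.
have -> : (\int[P]_w (Y w * g (X w))%:E = \int[P]_w
    (\sum_(i < size s) s`_i * (Y w * \1_(g @^-1` [set s`_i]) (X w)))%:E)%E.
  apply: eq_integral => w _; rewrite gE mulr_sumr.
  by congr (_%:E); apply: eq_bigr => i _; rewrite mulrCA.
have -> : (\int[P]_w (g (X w))%:E =
    \int[P]_w (\sum_(i < size s) s`_i * \1_(g @^-1` [set s`_i]) (X w))%:E)%E.
  by apply: eq_integral => w _; rewrite gE.
rewrite !ge0_integral_EFin_sum; last first.
- by move=> i w; apply: mulr_ge0.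
- by move=> i; apply: measurable_funM => //; exact: measurable_cst.
- by move=> i w; apply: mulr_ge0.
- by move=> i; apply: measurable_funM => //; exact: measurable_cst.
rewrite ge0_sume_distrr; last first.
  by move=> i _; apply: integral_ge0 => w _; rewrite lee_fin mulr_ge0.
apply: lee_sum => i _.
rewrite !ge0_integral_EFinZl// muleCA lee_wpmul2l ?lee_fin//.
apply: le_trans (YB _ (mg i)) _; apply: lee_wpmul2l; first by rewrite lee_fin.
under eq_integral do rewrite indic_comp.
by rewrite integral_indic ?setIT// -[X in measurable X]setTI; exact: mX.
Qed.

(** Monotone convergence along simple functions increasing to [f]. *)
Lemma integral_mul_comp_le (f : R -> R) :
  measurable_fun setT f -> (forall r, 0 <= f r) ->
  (\int[P]_w (Y w * f (X w))%:E <= c%:E * \int[P]_w (f (X w))%:E)%E.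
Proof.
move=> mf f0.
have mEf : measurable_fun setT (EFin \o f) by exact/measurable_EFinP.
have Ef0 r : setT r -> (0 <= (EFin \o f) r)%E by rewrite lee_fin.
pose h := nnsfun_approx measurableT mEf.
have hf r : (h n r)%:E @[n --> \oo] --> (f r)%:E.
  exact: (cvg_nnsfun_approx measurableT mEf Ef0).
have hle m n r : (m <= n)%N -> h m r <= h n r.
  by move=> mn; have /lefP := nd_nnsfun_approx measurableT mEf mn; exact.
have hfle n r : h n r <= f r.
  have nd : nondecreasing_seq (fun n => (h n r)%:E) by move=> a b ab; rewrite lee_fin hle.
  rewrite -lee_fin -(cvg_lim _ (hf r))// (cvg_lim _ (ereal_nondecreasing_cvgn nd))//.
  by apply: ereal_sup_ubound; exists n.
have mh n : measurable_fun setT (fun w => h n (X w)).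
  by apply: measurableT_comp.
have mfX : measurable_fun setT (fun w => f (X w)) by exact: measurableT_comp.
have YhE w : (Y w * f (X w))%:E = limn (fun n => (Y w * h n (X w))%:E).
  apply/esym/cvg_lim => //; under eq_fun do rewrite EFinM.
  by rewrite EFinM; apply: cvgeZl.
under eq_integral do rewrite YhE.
rewrite monotone_convergence//.
- apply: lime_le.
    apply: ereal_nondecreasing_is_cvgn => m n mn.
    apply: ge0_le_integral_EFin; [exact: measurable_funM|exact: measurable_funM| |].
      by move=> w; rewrite mulr_ge0.
    by move=> w; rewrite ler_wpM2l ?hle.
  apply: nearW => n; apply: le_trans (integral_mul_nnsfun_le (h n)) _.
  apply: lee_wpmul2l; first by rewrite lee_fin.
  exact: ge0_le_integral_EFin.
- by move=> n; apply/measurable_EFinP; exact: measurable_funM.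
- by move=> n w _; rewrite lee_fin mulr_ge0.
- by move=> w _ m n mn; rewrite lee_fin ler_wpM2l ?hle.
Qed.

End IndicatorToFunction.

Lemma prod_indic_comp {I : eqType} (X : I -> Omega -> R) (B : I -> set R)
    (J : seq I) w :
  \prod_(i <- J) \1_(B i) (X i w) =
  \1_(\bigcap_(i in [set` J]) (X i @^-1` B i)) w :> R.
Proof.
have [Bw|nBw] := pselect (forall i, i \in J -> B i (X i w)).
  rewrite big_seq big1; last by move=> i iJ; rewrite indicE mem_set//; exact: Bw.
  by rewrite indicE mem_set// => i iJ; exact: Bw.
rewrite indicE memNset; last by move=> h; apply: nBw => i iJ; exact: h.
apply/eqP; rewrite prodf_seq_eq0; apply/hasP.
have [i iJ nB] : exists2 i, i \in J & ~ B i (X i w).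
  by apply: contrapT => h; apply: nBw => i iJ; apply: contrapT => nB; apply: h; exists i.
by exists i => //; rewrite /= indicE memNset.
Qed.

(** Indices in [J1] carry functions, those in [J2] events. In the induction on [J1], the head [i]
    first moves to [J2] with an arbitrary event [D]; this is the hypothesis [YB] that lets the
    indicator of [D] be replaced by [f i]. With [J1] empty, only the product rule for events
    remains. *)
Lemma independent_prod_le {I : eqType} (S : set I) (X : I -> Omega -> R)
    (J1 J2 : seq I) (f : I -> R -> R) (b : I -> R) (B : I -> set R) :
  mutually_independent P S X -> uniq (J1 ++ J2) ->
  (forall i, i \in J1 ++ J2 -> S i) ->
  (forall i, S i -> measurable_fun setT (X i)) ->
  (forall i, measurable (B i)) ->
  (forall i, measurable_fun setT (f i)) -> (forall i r, 0 <= f i r) ->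
  (forall i, i \in J1 -> \int[P]_w (f i (X i w))%:E <= (b i)%:E)%E ->
  (\int[P]_w ((\prod_(i <- J1) f i (X i w)) * \prod_(i <- J2) \1_(B i) (X i w))%:E
   <= (\prod_(i <- J1) b i * \prod_(i <- J2) fine (P (X i @^-1` B i)))%:E)%E.
Proof.
move=> indep; elim: J1 J2 B => [|i J1 IH] J2 B uJ SJ mX mB mf f0 fb.
  under eq_integral do rewrite big_nil mul1r prod_indic_comp.
  rewrite big_nil mul1r integral_indic//; last first.
    apply: fin_bigcap_measurable => // i iJ.
    by rewrite -[X in measurable X]setTI; apply: mX => //; exact: SJ.
  rewrite setIT le_eqVlt; apply/orP; left; apply/eqP.
  transitivity (\prod_(i <- J2) P (X i @^-1` B i))%E; first exact: indep.
  rewrite -prodEFin big_seq [in RHS]big_seq; apply: eq_bigr => i iJ.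
  rewrite fineK// fin_num_measure//.
  by rewrite -[X in measurable X]setTI; apply: mX => //; exact: SJ.
move: (uJ); rewrite /= mem_cat negb_or => /andP[/andP[iJ1 iJ2] uJ'].
have mXi : measurable_fun setT (X i) by apply: mX; apply: SJ; rewrite mem_head.
have mY : measurable_fun setT
    (fun w => (\prod_(j <- J1) f j (X j w)) * \prod_(j <- J2) \1_(B j) (X j w)).
  apply: measurable_funM; apply: measurable_prod => j jJ.
    apply: measurableT_comp => //; apply: mX; apply: SJ.
    by rewrite inE mem_cat jJ orbT.
  apply: measurable_indic_comp => //; apply: mX; apply: SJ.
  by rewrite inE mem_cat jJ !orbT.
have b0 j : j \in i :: J1 -> 0 <= b j.
  move=> /fb; rewrite -lee_fin; apply: le_trans.
  by apply: integral_ge0 => w _; rewrite lee_fin.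
pose c := \prod_(j <- J1) b j * \prod_(j <- J2) fine (P (X j @^-1` B j)).
have c0 : 0 <= c.
  rewrite mulr_ge0//; last by apply: prodr_ge0 => j _; rewrite fine_ge0.
  by rewrite big_seq prodr_ge0// => j jJ; rewrite b0// inE jJ orbT.
have YB D : measurable D -> (\int[P]_w ((\prod_(j <- J1) f j (X j w)) *
    (\prod_(j <- J2) \1_(B j) (X j w)) * \1_D (X i w))%:E
    <= c%:E * P (X i @^-1` D))%E.
  (* Since [i] is not in [J2], overriding the event at [i] changes none of the factors over [J2]. *)
  move=> mD; pose B' j := if j == i then D else B j.
  have BB' (F : set R -> I -> R) :
      \prod_(j <- J2) F (B' j) j = \prod_(j <- J2) F (B j) j.
    rewrite !big_seq; apply: eq_bigr => j jJ; rewrite /B'.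
    by case: eqP jJ => // ->; rewrite (negbTE iJ2).
  have -> : (\int[P]_w ((\prod_(j <- J1) f j (X j w)) *
      (\prod_(j <- J2) \1_(B j) (X j w)) * \1_D (X i w))%:E =
      \int[P]_w ((\prod_(j <- J1) f j (X j w)) *
        \prod_(j <- i :: J2) \1_(B' j) (X j w))%:E)%E.
    apply: eq_integral => w _.
    by rewrite big_cons (BB' (fun A j => \1_A (X j w))) {1}/B' eqxx mulrCA mulrC.
  have mXD : measurable (X i @^-1` D).
    by rewrite -[X in measurable X]setTI; exact: mXi.
  have -> : (c%:E * P (X i @^-1` D))%E =
      (\prod_(j <- J1) b j * \prod_(j <- i :: J2) fine (P (X j @^-1` B' j)))%:E.
    rewrite big_cons (BB' (fun A j => fine (P (X j @^-1` A)))) {1}/B' eqxx.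
    by rewrite mulrCA [in RHS]EFinM fineK ?fin_num_measure// muleC.
  apply: IH => //.
  - by rewrite -cat1s uniq_catCA cat1s.
  - move=> j jJ; apply: SJ; move: jJ; by rewrite /= !(inE, mem_cat) orbCA.
  - by move=> j; rewrite /B'; case: ifP.
  - by move=> j jJ; apply: fb; rewrite inE jJ orbT.
have -> : (\int[P]_w ((\prod_(j <- i :: J1) f j (X j w)) *
      \prod_(j <- J2) \1_(B j) (X j w))%:E =
    \int[P]_w ((\prod_(j <- J1) f j (X j w)) *
      (\prod_(j <- J2) \1_(B j) (X j w)) * f i (X i w))%:E)%E.
  by apply: eq_integral => w _; rewrite big_cons -mulrA mulrC.
apply: le_trans (integral_mul_comp_le _ _ _ mXi mY _ c0 YB _ (mf i) (f0 i)) _.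
  by move=> w; rewrite mulr_ge0// prodr_ge0// => j _; rewrite indicE.
rewrite big_cons -mulrA mulrC -/c [leRHS]EFinM; apply: lee_wpmul2l; first by rewrite lee_fin.
by apply: fb; rewrite mem_head.
Qed.

End IndependentProducts.

(** * Query histories and their probabilities *)

Section Histories.
Context {R : realType}.
Variable p : seq bool -> R.

Fixpoint bits (n : nat) : seq (seq bool) :=
  if n is n'.+1 then map (cons true) (bits n') ++ map (cons false) (bits n')
  else [:: [::]].

Lemma size_bits n h : h \in bits n -> size h = n.
Proof.
elim: n h => [|n IH] h /=; first by rewrite inE => /eqP ->.
by rewrite mem_cat => /orP[] /mapP[h' /IH <- ->].
Qed.

Lemma mem_bits n h : size h = n -> h \in bits n.
Proof.
elim: n h => [|n IH] [|b h]//= [hn].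
rewrite mem_cat; apply/orP.
by case: b; [left|right]; apply/mapP; exists h => //; exact: IH.
Qed.

Lemma uniq_bits n : uniq (bits n).
Proof.
elim: n => //= n IH; rewrite cat_uniq !map_inj_uniq ?IH; [|by move=> ? ? []..].
by rewrite andbT; apply/hasPn => h /mapP[h' _ ->]; apply/mapP => -[].
Qed.

(** The probability of the history when the coins are independent and uniform. *)
Fixpoint hweight (h : seq bool) : R :=
  if h is b :: h' then hweight h' * (if b then p h' else 1 - p h') else 1.

Fixpoint hist (u : nat -> R) (n : nat) : seq bool :=
  if n is n'.+1 then (u n' < p (hist u n')) :: hist u n' else [::].

Lemma size_hist u n : size (hist u n) = n.
Proof. by elim: n => //= n ->. Qed.

Lemma drop_hist u n t : (t <= n)%N -> drop (n - t) (hist u n) = hist u t.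
Proof.
elim: n => [|n IH]; first by rewrite leqn0 => /eqP ->.
rewrite leq_eqVlt => /orP[/eqP ->|tn]; first by rewrite subnn drop0.
by rewrite subSn//= IH.
Qed.

Lemma hsum_hist (F : seq bool -> bool -> R) u n :
  hsum F (hist u n) = \sum_(t < n) F (hist u t) (u t < p (hist u t)).
Proof. by elim: n => [|n IH]; rewrite ?big_ord0// big_ord_recr /= IH. Qed.

(** The constraint that [h] puts on coin [n]. The past of a round is part of [h], so the threshold
    is a fixed number and the event of a history is a product event in the coins. *)
Fixpoint coin_set (h : seq bool) (n : nat) : set R :=
  if h is b :: h' then
    if n == size h' then [set r | (r < p h') = b] else coin_set h' n
  else setT.

Lemma measurable_coin_set h n : measurable (coin_set h n).
Proof.
elim: h => //= b h IH; case: ifP => // _.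
case: b.
  rewrite (_ : [set _ | _] = `]-oo, (p h)[%classic); first exact: measurable_itv.
  by apply/seteqP; split => r /=; rewrite in_itv.
rewrite (_ : [set _ | _] = `[p h, +oo[%classic); first exact: measurable_itv.
apply/seteqP; split => r /=; rewrite in_itv/= andbT.
  by move=> /negbT; rewrite -leNgt.
by move=> pr; apply/negbTE; rewrite -leNgt.
Qed.

Lemma prod_coin_set_cons (g : set R -> nat -> R) b h :
  \prod_(n < (size h).+1) g (coin_set (b :: h) n) n =
  \prod_(n < size h) g (coin_set h n) n * g [set r | (r < p h) = b] (size h).
Proof.
rewrite big_ord_recr /= eqxx; congr (_ * _).
by apply: eq_bigr => n _; rewrite ltn_eqF.
Qed.

Lemma prod_indic_coin_set_hist u n :
  \prod_(t < n) \1_(coin_set (hist u n) t) (u t) = 1 :> R.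
Proof.
elim: n => [|n IH]; first by rewrite big_ord0.
have := prod_coin_set_cons (fun A t => \1_A (u t)) (u n < p (hist u n)) (hist u n).
rewrite size_hist => ->; rewrite IH mul1r indicE mem_set//.
Qed.

Hypothesis p01 : forall h, 0 <= p h <= 1.

Lemma hweight_ge0 h : 0 <= hweight h.
Proof.
elim: h => //= b h IH; rewrite mulr_ge0//.
by have /andP[p0 p1] := p01 h; case: b => //; rewrite subr_ge0.
Qed.

(** The weighted sum is the expectation of [Z] after [n] rounds; splitting on the latest bit amounts
    to conditioning on the past. *)
Lemma sum_hweight_supermartingale (Z : seq bool -> R) n :
  (forall h, p h * Z (true :: h) + (1 - p h) * Z (false :: h) <= Z h) ->
  \sum_(h <- bits n) hweight h * Z h <= Z [::].
Proof.
move=> ZZ; elim: n => [|n IH] /=; first by rewrite big_seq1 mul1r.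
rewrite big_cat/= !big_map -big_split/=; apply: le_trans IH.
apply: ler_sum => h _; rewrite -!mulrA -mulrDr.
by rewrite ler_wpM2l ?hweight_ge0.
Qed.

(** The exponential of the running sum is a supermartingale started at 1. *)
Lemma sum_hweight_expR (F : seq bool -> bool -> R) n :
  (forall h, p h * expR (F h true) + (1 - p h) * expR (F h false) <= 1) ->
  \sum_(h <- bits n) hweight h * expR (hsum F h) <= 1.
Proof.
move=> FF; apply: le_trans (sum_hweight_supermartingale (fun h => expR (hsum F h)) _ _) _.
  move=> h /=; rewrite !expRD !(mulrCA _ (expR (hsum F h))) -mulrDr.
  by rewrite ler_piMr ?expR_ge0.
by rewrite /= expR0.
Qed.

Lemma sum_hweight n : \sum_(h <- bits n) hweight h <= 1.
Proof.
have := @sum_hweight_expR (fun _ _ => 0) n.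
under eq_bigr => h _.
  rewrite (_ : hsum _ h = 0); last by elim: h => //= b h ->; rewrite addr0.
  rewrite expR0 mulr1; over.
by apply => h; rewrite expR0; lra.
Qed.

End Histories.

(** * Simultaneous tail bounds over all histories *)

Section HistoryTail.
Context {dT : measure_display} {Omega : measurableType dT} {R : realType}.
Variables (P : probability Omega R) (T : nat) (eta : R) (xi U : nat -> Omega -> R).
Variable p : seq bool -> R.
Hypothesis p01 : forall h, 0 <= p h <= 1.
Hypothesis subg : forall t, (t < T)%N -> zero_mean_subgaussian P (xi t) eta.
Hypothesis unif : forall t, (t < T)%N -> uniform01 P (U t).
Hypothesis indep : mutually_independent P [set i : bool * nat | (i.2 < T)%N]
  (fun i => if i.1 then xi i.2 else U i.2).

Let coins h w : R := \prod_(t < T) \1_(coin_set p h t) (U t w).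

Lemma measurable_noise t : (t < T)%N -> measurable_fun setT (xi t).
Proof. by move=> /subg[]. Qed.

Lemma measurable_coin t : (t < T)%N -> measurable_fun setT (U t).
Proof. by move=> /unif[]. Qed.

Lemma probability_coin_set h : (size h <= T)%N ->
  \prod_(t < size h) fine (P (U t @^-1` coin_set p h t)) = hweight p h.
Proof.
elim: h => [|b h IH] hT; first by rewrite big_ord0.
rewrite (prod_coin_set_cons p (fun A t => fine (P (U t @^-1` A)))) IH /=; last exact: ltnW.
congr (_ * _); have [mU PU] := unif _ hT.
have Pp : P (U (size h) @^-1` [set r | r < p h]) = (p h)%:E by exact: PU (p01 h).
clear hT IH; case: b.
  by rewrite (_ : _ @^-1` _ = U (size h) @^-1` [set r | r < p h]) ?Pp.
rewrite (_ : _ @^-1` _ = ~` (U (size h) @^-1` [set r | r < p h])).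
  rewrite probability_setC ?Pp -?EFinB//.
  rewrite -[X in measurable X]setTI; apply: mU => //.
  rewrite (_ : [set _ | _] = `]-oo, (p h)[%classic); first exact: measurable_itv.
  by apply/seteqP; split => r /=; rewrite in_itv.
apply/seteqP; split => w /=; first by move=> ->.
by move=> /negP/negbTE.
Qed.

(** On the event of a fixed history, coefficients that depend on the history are constants, and the
    noise is independent of that event. Adaptive coefficients are thus treated one history at a
    time. *)
Lemma expectation_coins_expR (c : nat -> R) h : size h = T ->
  (\int[P]_w (expR (\sum_(t < T) c t * xi t w) * coins h w)%:E
   <= (expR (\sum_(t < T) (c t) ^+ 2 * eta ^+ 2 / 2) * hweight p h)%:E)%E.
Proof.
move=> hT.
pose X (i : bool * nat) : Omega -> R := if i.1 then xi i.2 else U i.2.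
(* The tag [true] marks noise variables, which enter through exponentials; [false] marks coins,
   which enter through events. *)
have := @independent_prod_le _ _ _ P _ [set i : bool * nat | (i.2 < T)%N] X
  [seq (true, t) | t <- iota 0 T] [seq (false, t) | t <- iota 0 T]
  (fun i r => expR (c i.2 * r)) (fun i => expR ((c i.2) ^+ 2 * eta ^+ 2 / 2))
  (fun i => coin_set p h i.2) indep.
have mkT (F : nat -> R) : \prod_(t <- iota 0 T) F t = \prod_(t < T) F t.
  by rewrite -(big_mkord xpredT) /index_iota subn0.
rewrite !big_map !mkT; under eq_integral do rewrite !big_map !mkT/= -expR_sum.
rewrite -hT probability_coin_set ?hT// /X /= -expR_sum; apply => //.
- rewrite cat_uniq !map_inj_uniq ?iota_uniq; [|by move=> ? ? []..].
  by rewrite andbT; apply/hasPn => i /mapP[t _ ->]; apply/mapP => -[].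
- by move=> i; rewrite mem_cat => /orP[] /mapP[t] + ->; rewrite mem_iota.
- by move=> [[] t] /= tT; [exact: measurable_noise|exact: measurable_coin].
- by move=> i; exact: measurable_coin_set.
- move=> i; apply: (measurableT_comp (f := expR)); first exact: measurable_expR.
  by apply: measurable_funM => //; exact: measurable_cst.
- move=> i /mapP[t + ->]; rewrite mem_iota /= => tT.
  have [_ [_ [_ /(_ (c t))]]] := subg _ tT; by rewrite unlock.
Qed.

Lemma measurable_coins h : measurable_fun setT (coins h).
Proof.
apply: measurable_prod => t _; apply: measurable_indic_comp.
  exact: measurable_coin.
exact: measurable_coin_set.
Qed.

Lemma coins_ge0 h w : 0 <= coins h w.
Proof. by apply: prodr_ge0 => t _; rewrite indicE. Qed.

Lemma measurable_expR_noise (c : nat -> R) (a : R) :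
  measurable_fun setT (fun w => expR (\sum_(t < T) c t * xi t w - a)).
Proof.
apply: (measurableT_comp (f := expR)); first exact: measurable_expR.
apply: measurable_funB; last exact: measurable_cst.
apply: measurable_sum => t; apply: measurable_funM; first exact: measurable_cst.
exact: measurable_noise.
Qed.

Lemma expectation_coins h : size h = T ->
  (\int[P]_w (coins h w)%:E <= (hweight p h)%:E)%E.
Proof.
move=> /(expectation_coins_expR (fun=> 0)).
under eq_integral do under eq_bigr do rewrite mul0r.
under eq_integral do rewrite big1// expR0 mul1r.
by rewrite big1 ?expR0 ?mul1r// => t _; rewrite expr2 !mul0r.
Qed.

(** The weighted noise has variance proxy at most 1, so the logarithm of its exponential moment is
    at most 1 / 2, which the subtracted 1 / 2 cancels. *)
Lemma expectation_coins_expR_half (c : nat -> R) h : size h = T ->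
  eta ^+ 2 * (\sum_(t < T) (c t) ^+ 2) <= 1 ->
  (\int[P]_w (coins h w * expR (\sum_(t < T) c t * xi t w - 1 / 2))%:E
   <= (hweight p h)%:E)%E.
Proof.
move=> hT c1.
under eq_integral do rewrite expRD mulrC mulrAC -mulrC.
rewrite ge0_integral_EFinZl ?expR_ge0//; last 2 first.
- apply: measurable_funM; last exact: measurable_coins.
  have := measurable_expR_noise c 0.
  by under eq_fun do rewrite subr0.
- by move=> w; rewrite mulr_ge0 ?expR_ge0 ?coins_ge0.
apply: (@le_trans _ _ ((expR (- (1 / 2)))%:E *
  (expR (\sum_(t < T) (c t) ^+ 2 * eta ^+ 2 / 2) * hweight p h)%:E)%E).
  apply: lee_wpmul2l; first by rewrite lee_fin expR_ge0.
  exact: expectation_coins_expR.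
rewrite -EFinM lee_fin mulrA -expRD ler_piMl ?hweight_ge0// expR_le1.
under eq_bigr do rewrite -mulrA.
rewrite -mulr_suml; move: c1; set s := \sum_(t < T) _; lra.
Qed.

(* Markov's inequality for a single random variable, the sum of all the
   nonnegative quantities to be controlled. *)
Lemma history_tail_bound (I J : finType) (F : I -> seq bool -> bool -> R)
    (c : J -> seq bool -> nat -> R) (B delta : R) :
  (forall i h, p h * expR (F i h true) + (1 - p h) * expR (F i h false) <= 1) ->
  (forall j h, size h = T -> eta ^+ 2 * (\sum_(t < T) (c j h t) ^+ 2) <= 1) ->
  0 < B -> #|I|%:R + #|J|%:R <= B * delta ->
  exists E : set Omega, [/\ measurable E, ((1 - delta)%:E <= P E)%E &
    forall w, E w -> let h := hist p (fun t => U t w) T in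
      (forall i, expR (hsum (F i) h) <= B) /\
      (forall j, expR (\sum_(t < T) c j h t * xi t w - 1 / 2) <= B)].
Proof.
move=> FF cc B0 IJ.
pose A h := \sum_(i : I) expR (hsum (F i) h).
pose N h w := \sum_(j : J) expR (\sum_(t < T) c j h t * xi t w - 1 / 2).
(* [coins h] is the indicator of the event that [h] is realised, so [S] evaluates [A] and [N] at the
   realised history. *)
pose S w := \sum_(h <- bits T) coins h w * (A h + N h w).
have A0 h : 0 <= A h by apply: sumr_ge0 => i _; exact: expR_ge0.
have N0 h w : 0 <= N h w by apply: sumr_ge0 => i _; exact: expR_ge0.
have mN h : measurable_fun setT (N h).
  by apply: measurable_sum => j; exact: measurable_expR_noise.
have mSh h : measurable_fun setT (fun w => coins h w * (A h + N h w)).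
  apply: measurable_funM; first exact: measurable_coins.
  by apply: measurable_funD => //; exact: measurable_cst.
have Sh0 h w : 0 <= coins h w * (A h + N h w).
  by rewrite mulr_ge0 ?coins_ge0 ?addr_ge0.
have mS : measurable_fun setT S by exact: measurable_sum.
have S0 w : 0 <= S w by exact: sumr_ge0.
have intS : (\int[P]_w (S w)%:E <= (#|I|%:R + #|J|%:R)%:E)%E.
  rewrite ge0_integral_EFin_sum//.
  apply: (@le_trans _ _ (\sum_(h <- bits T) (hweight p h * (A h + #|J|%:R))%:E)%E).
    rewrite big_seq [leRHS]big_seq; apply: lee_sum => h /size_bits hT.
    under eq_integral do rewrite mulrDr EFinD.
    rewrite ge0_integralD//; last 4 first.
    - by move=> w _; rewrite lee_fin mulr_ge0 ?coins_ge0.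
    - apply/measurable_EFinP; apply: measurable_funM; first exact: measurable_coins.
      exact: measurable_cst.
    - by move=> w _; rewrite lee_fin mulr_ge0 ?coins_ge0.
    - by apply/measurable_EFinP; apply: measurable_funM; first exact: measurable_coins.
    rewrite mulrDr EFinD; apply: leeD.
      under eq_integral do rewrite mulrC.
      rewrite ge0_integral_EFinZl//; [|exact: measurable_coins|exact: coins_ge0].
      rewrite mulrC EFinM; apply: lee_wpmul2l; first by rewrite lee_fin.
      exact: expectation_coins.
    under eq_integral do rewrite mulr_sumr.
    rewrite ge0_integral_EFin_sum; last 2 first.
    - move=> j; apply: measurable_funM; first exact: measurable_coins.
      exact: measurable_expR_noise.
    - by move=> j w; rewrite mulr_ge0 ?coins_ge0 ?expR_ge0.
    apply: (@le_trans _ _ (\sum_(j : J) (hweight p h)%:E)%E).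
      by apply: lee_sum => j _; apply: expectation_coins_expR_half => //; exact: cc.
    by rewrite sumEFin sumr_const mulr_natr.
  rewrite sumEFin lee_fin; under eq_bigr do rewrite mulrDr.
  rewrite big_split/= -mulr_suml lerD//; last first.
    by rewrite ler_piMl// sum_hweight.
  under eq_bigr do rewrite mulr_sumr.
  rewrite exchange_big/= -sum1_card natr_sum; apply: ler_sum => i _.
  exact: sum_hweight_expR.
pose E := S @^-1` `]-oo, B].
have mE : measurable E by rewrite /E -[X in measurable X]setTI; apply: mS.
exists E; split=> //; last first.
  move=> w; rewrite /E /= in_itv/= => SB; set h := hist _ _ _.
  have : A h + N h w <= B.
    apply: le_trans SB; rewrite /S (bigD1_seq h) ?uniq_bits ?mem_bits ?size_hist//=.
    rewrite /coins prod_indic_coin_set_hist mul1r lerDl.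
    by apply: sumr_ge0 => h' _; exact: Sh0.
  move=> ANB; split=> [i|j].
    apply: le_trans ANB; rewrite /A (bigD1 i)//= -addrA lerDl.
    by rewrite addr_ge0// sumr_ge0// => k _; exact: expR_ge0.
  apply: le_trans ANB; rewrite /N (bigD1 j)//= addrCA lerDl.
  by rewrite addr_ge0// sumr_ge0// => k _; exact: expR_ge0.
(* [B] times the indicator of the complement of [E] is at most [S]. *)
have mark : (B%:E * P (~` E) <= (#|I|%:R + #|J|%:R)%:E)%E.
  apply: le_trans intS.
  have mEc : measurable (~` E) by exact: measurableC.
  rewrite -[X in P X]setIT -(integral_indic P measurableT mEc).
  have i0 w : 0 <= \1_(~` E) w :> R by rewrite indicE.
  rewrite -ge0_integral_EFinZl ?(ltW B0)//.
  apply: ge0_le_integral_EFin => //.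
  - by apply: measurable_funM; [exact: measurable_cst|exact: measurable_indic].
  - by move=> w; rewrite mulr_ge0// ltW.
  - move=> w; rewrite indicE; case: (boolP (w \in _)) => [|_]; last by rewrite mulr0.
    rewrite inE /E /= in_itv/= => /negP; rewrite -ltNge mulr1; exact: ltW.
have fP := fin_num_measure P _ mE.
have : (B%:E * P (~` E) <= (B * delta)%:E)%E by apply: le_trans mark _; rewrite lee_fin.
rewrite probability_setC// -(fineK fP) -EFinB -EFinM !lee_fin ler_pM2l//.
by lra.
Qed.

End HistoryTail.

(** * Prediction error along a run *)

Lemma inner_cauchy_schwarz {R : realType} {d} (a b : 'rV[R]_d) :
  inner a b ^+ 2 <= inner a a * inner b b.
Proof.
have [->|b0] := eqVneq b 0; first by rewrite innerC !inner0l expr2 mul0r mulr0.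
have bb := inner_gt0 _ b0.
have := inner_ge0 (inner b b *: a - inner a b *: b).
rewrite !innerDl !innerNl !innerDr !innerNr !innerZl !innerZr (innerC b a).
move: (inner a a) (inner a b) (inner b b) bb => u v s s0 h.
have : 0 <= s * (u * s - v ^+ 2) by lra.
by rewrite pmulr_rge0// subr_ge0.
Qed.

Lemma sqr_clip_sub_le {R : realType} (a b : R) : `|b| <= 1 ->
  (clip a - b) ^+ 2 <= (a - b) ^+ 2 /\ (clip a - b) ^+ 2 <= 4.
Proof.
rewrite ler_norml => /andP[b1 b2]; rewrite /clip /Num.min /Num.max.
by case: (ltP (-1) a) => ?; case: ltP => ?; split; nra.
Qed.

Section PrefixBits.
Context {R : realType}.

(* The history lists the latest round first, hence the reversal. *)
Definition bit_at (h : seq bool) (s : nat) : bool := nth false (rev h) s.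

(** Rewrites a history sum over a fixed range of rounds, the form in which the noise is handled;
    beyond the history [bit_at] is false. *)
Lemma hsum_bit_at (f : nat -> R) h n : (size h <= n)%N ->
  hsum (fun h' b => b%:R * f (size h')) h = \sum_(s < n) (bit_at h s)%:R * f s.
Proof.
elim: h => [|b h IH] hn /=.
  by rewrite big1// => s _; rewrite /bit_at nth_nil mul0r.
pose i0 : 'I_n := Ordinal (hn : (size h < n)%N).
rewrite IH 1?ltnW// (bigD1 i0)//= [in RHS](bigD1 i0)//=.
rewrite {1}/bit_at nth_default ?size_rev// mul0r add0r [RHS]addrC; congr (_ + _).
  apply: eq_bigr => s sh; congr (_%:R * _).
  have {}sh : (s : nat) != size h by [].
  rewrite /bit_at rev_cons nth_rcons size_rev; case: ltngtP sh => // sh _.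
  by rewrite nth_default// size_rev ltnW.
by rewrite /bit_at rev_cons nth_rcons size_rev ltnn eqxx.
Qed.

End PrefixBits.

Section Run.
Context {R : realType} {d : nat}.
Variables (C eta alpha : R) (theta : 'rV[R]_d) (x : nat -> 'rV[R]_d).

Definition query_prob (h : seq bool) : R :=
  Num.min 1 (alpha * Delta eta x (size h) (design C x h)).

(** Its inner products with the queried inputs are the coefficients of their labels in the unclipped
    prediction. *)
Definition dual_dir (h : seq bool) : 'rV[R]_d := x (size h) *m invmx (design C x h).

(** Normalises the noise part of the prediction to variance proxy at most 1. At leverage 0 it is 0,
    by the convention on inverses. *)
Definition noise_scale (h : seq bool) : R :=
  (etat eta * Num.sqrt (leverage C x h))^-1.

Hypothesis C0 : 0 < C.
Hypothesis alpha0 : 0 < alpha.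

Lemma etat_ge1 : 1 <= etat eta.
Proof. by rewrite /etat le_max lexx. Qed.

Lemma DeltaE h : Delta eta x (size h) (design C x h) =
  etat eta ^+ 2 * Num.min 1 (leverage C x h).
Proof. by []. Qed.

Lemma min1_leverage_ge0 h : 0 <= Num.min 1 (leverage C x h).
Proof. by rewrite le_min ler01 leverage_ge0. Qed.

Lemma query_prob01 h : 0 <= query_prob h <= 1.
Proof.
rewrite /query_prob ge_min lexx andbT le_min ler01 DeltaE.
apply: mulr_ge0; first exact: ltW.
by apply: mulr_ge0; [exact: sqr_ge0|exact: min1_leverage_ge0].
Qed.

Lemma inner_design2 h (z v : 'rV[R]_d) : inner (z *m design C x h) v =
  C ^- 2 * inner z v +
  hsum (fun h' b => b%:R * (inner z (x (size h')) * inner v (x (size h')))) h.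
Proof.
elim: h => /= [|[] h IH]; first by rewrite mul_mx_scalar innerZl addr0.
  by rewrite mulmxDr innerDl IH mul1r addrA mul_rank1 innerZl (innerC v).
by rewrite IH mul0r addr0.
Qed.

Lemma dual_dirK h : dual_dir h *m design C x h = x (size h).
Proof. by rewrite mulmxKV// posdef_unit//; exact: posdef_design. Qed.

(** The first term controls the regularisation bias of the prediction, the second the variance of
    its noise; both are thus at most the leverage. *)
Lemma leverage_dual_dir h : leverage C x h = C ^- 2 * inner (dual_dir h) (dual_dir h) +
  hsum (fun h' b => b%:R * inner (dual_dir h) (x (size h')) ^+ 2) h.
Proof. by rewrite -inner_design dual_dirK innerC. Qed.

Lemma hsum_sqr_inner_ge0 h (z : 'rV[R]_d) :
  0 <= hsum (fun h' b => b%:R * inner z (x (size h')) ^+ 2) h.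
Proof. by elim: h => //= b h IH; rewrite addr_ge0// mulr_ge0 ?sqr_ge0. Qed.

(** Before scaling, the sum of squares is the second term of [leverage_dual_dir]; moreover
    [eta <= etat eta]. *)
Lemma noise_coef_bound h n : (size h <= n)%N -> 0 <= eta ->
  eta ^+ 2 * \sum_(s < n)
    (noise_scale h * ((bit_at h s)%:R * inner (dual_dir h) (x s))) ^+ 2 <= 1.
Proof.
move=> hn eta0.
under eq_bigr => s _.
  rewrite exprMn exprMn (_ : (bit_at h s)%:R ^+ 2 = (bit_at h s)%:R); last first.
    by case: bit_at; rewrite ?expr1n// expr2 mul0r.
  over.
rewrite -mulr_sumr -(hsum_bit_at (fun s => inner (dual_dir h) (x s) ^+ 2))//.
have e1 := etat_ge1.
set S := hsum _ _.
have S0 : 0 <= S by exact: hsum_sqr_inner_ge0.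
have Sg : S <= leverage C x h.
  rewrite leverage_dual_dir lerDr mulr_ge0 ?inner_ge0// invr_ge0 sqr_ge0//.
have g0 := leverage_ge0 C x C0 h.
rewrite /noise_scale exprVn exprMn sqr_sqrtr//.
move: (leverage C x h) Sg g0 => g Sg g0.
have [->|gn0] := eqVneq g 0; first by rewrite mulr0 invr0 mul0r mulr0.
have gp : 0 < g by rewrite lt_def gn0.
have ee : eta ^+ 2 <= etat eta ^+ 2.
  by rewrite ler_sqr ?nnegrE ?(le_trans eta0)// /etat le_max lexx orbT.
have ep : 0 < etat eta ^+ 2 * g by rewrite mulr_gt0// exprn_gt0// (lt_le_trans ltr01).
rewrite mulrCA mulrC ler_pdivrMr// mul1r ler_pM ?sqr_ge0//.
Qed.

Variables (xiv uv : nat -> R).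
Let hst := hist query_prob uv.

(** The labels never enter the matrix, so it is a function of the query bits alone. *)
Lemma state_design t : (state C eta alpha theta x xiv uv t).1 = design C x (hst t).
Proof.
elim: t => //= t IH; rewrite -/hst /query IH.
have -> : (uv t < query_prob (hst t)) =
    (uv t < Num.min 1 (alpha * Delta eta x t (design C x (hst t)))).
  by rewrite /query_prob size_hist.
by rewrite size_hist; case: ifP => _ /=.
Qed.

Lemma q_hist t : q C eta alpha theta x xiv uv t = (uv t < query_prob (hst t)).
Proof. by rewrite /q /query state_design /query_prob size_hist. Qed.

Lemma inner_state t (z : 'rV[R]_d) :
  inner z (state C eta alpha theta x xiv uv t).2 =
  hsum (fun h' b => b%:R * (inner z (x (size h')) * label theta x xiv (size h'))) (hst t).
Proof.
elim: t => [|t IH] /=; first by rewrite innerC inner0l.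
rewrite -/hst -IH -q_hist size_hist /q.
case: ifP => _ /=; last by rewrite mul0r addr0.
by rewrite innerDr innerZr mul1r (mulrC (label _ _ _ _)).
Qed.

Lemma query_complexity_hist T : query_complexity C eta alpha theta x xiv uv T =
  hsum (fun _ b => b%:R) (hst T).
Proof. by rewrite hsum_hist; apply: eq_bigr => t _; rewrite q_hist. Qed.

Definition noise_sum (h : seq bool) : R :=
  hsum (fun h' b => b%:R * (inner (dual_dir h) (x (size h')) * xiv (size h'))) h.

(** The unclipped error is a noise term [N] minus a bias [W]. The hypothesis on the noise bounds
    [N], Cauchy-Schwarz with the norm bound on [theta] bounds [W], and (N - W)^2 <= 2 N^2 + 2
    W^2. *)
Lemma prediction_error t (b : R) : 1 <= b -> norm2 theta <= C ->
  `|inner theta (x t)| <= 1 -> `|noise_scale (hst t) * noise_sum (hst t)| <= b ->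
  (prediction C eta alpha theta x xiv uv t - inner theta (x t)) ^+ 2
  <= 4 * b ^+ 2 * Delta eta x t (design C x (hst t)).
Proof.
move=> b1 thC thx noise.
set h := hst t; have sh : size h = t by exact: size_hist.
pose z := dual_dir h.
(* Writing [x t] as [z] times the design splits [inner theta (x t)] into a regularisation term and
   the noiseless part of the prediction. *)
have predE : (x t *m theta_hat C eta alpha theta x xiv uv t) 0 0 =
    inner theta (x t) + noise_sum h - C ^- 2 * inner z theta.
  have -> : inner theta (x t) = C ^- 2 * inner z theta +
      hsum (fun h' b => b%:R * (inner z (x (size h')) * inner theta (x (size h')))) h.
    by rewrite -sh -dual_dirK innerC inner_design2.
  rewrite /theta_hat state_design -/h mulmxA (_ : x t *m invmx _ = z); last first.
    by rewrite /z /dual_dir sh.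
  rewrite -/(inner _ _) inner_state -/h.
  rewrite /noise_sum -/z.
  have -> : hsum (fun h' b => b%:R * (inner z (x (size h')) * label theta x xiv (size h'))) h =
     hsum (fun h' b => b%:R * (inner z (x (size h')) * inner theta (x (size h')))) h +
     hsum (fun h' b => b%:R * (inner z (x (size h')) * xiv (size h'))) h.
    rewrite -hsumD; elim: (h) => //= c h' ->; congr (_ + _).
    by rewrite /label -mulrDr -mulrDr.
  by ring.
have [c1 c2] := sqr_clip_sub_le ((x t *m theta_hat C eta alpha theta x xiv uv t) 0 0) _ thx.
have -> : Delta eta x t (design C x h) = etat eta ^+ 2 * Num.min 1 (leverage C x h).
  by rewrite -DeltaE sh.
have e1 := etat_ge1.
have be : 1 <= b ^+ 2 * etat eta ^+ 2.
  by rewrite -exprMn -[leLHS](expr1n _ 2) ler_sqr ?nnegrE; nra.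
suff err : (prediction C eta alpha theta x xiv uv t - inner theta (x t)) ^+ 2 <=
    4 * (b ^+ 2 * etat eta ^+ 2) * leverage C x h.
  (* When the leverage exceeds 1, clipping bounds the error by 4. *)
  rewrite -mulrA [b ^+ 2 * _]mulrA mulrA /Num.min; case: ifP => _; last exact: err.
  by apply: le_trans c2 _; lra.
apply: le_trans c1 _; rewrite predE.
set N := noise_sum h; set W := C ^- 2 * inner z theta.
have g0 := leverage_ge0 C x C0 h.
have C2 : 0 < C ^+ 2 by rewrite exprn_gt0.
have C2i : 0 < C ^- 2 by rewrite invr_gt0.
have zg : C ^- 2 * inner z z <= leverage C x h.
  by rewrite leverage_dual_dir lerDl hsum_sqr_inner_ge0.
have W2 : W ^+ 2 <= leverage C x h.
  apply: le_trans zg; rewrite /W exprMn.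
  have cs := inner_cauchy_schwarz z theta.
  have tt := norm2_le theta C (ltW C0) thC.
  have : inner z theta ^+ 2 <= inner z z * C ^+ 2.
    by apply: le_trans cs _; rewrite ler_wpM2l// inner_ge0.
  move=> h1; rewrite expr2 -mulrA; apply: ler_wpM2l; first exact: ltW.
  by rewrite mulrC ler_pdivrMr.
have N2 : N ^+ 2 <= b ^+ 2 * etat eta ^+ 2 * leverage C x h.
  move: noise; rewrite -/h -/N /noise_scale => noise.
  (* At leverage 0 the hypothesis on the scaled noise is vacuous, but then [z = 0] and the noise
     term vanishes. *)
  have [gE|gn0] := eqVneq (leverage C x h) 0.
    suff -> : N = 0 by rewrite gE mulr0 expr2 mul0r.
    have z0 : z = 0.
      apply/eqP; rewrite -inner_eq0 eq_le inner_ge0 andbT.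
      by rewrite -(ler_pM2l C2i) mulr0 -gE.
    rewrite /N /noise_sum -/z z0; elim: (h) => //= c h' ->.
    by rewrite inner0l mul0r mulr0 addr0.
  have gp : 0 < leverage C x h by rewrite lt_def gn0.
  have sp : 0 < etat eta * Num.sqrt (leverage C x h).
    by rewrite mulr_gt0 ?sqrtr_gt0// (lt_le_trans ltr01).
  move: noise; rewrite normrM gtr0_norm ?invr_gt0// mulrC ler_pdivrMr// => noise.
  rewrite -[N ^+ 2]real_normK ?num_real//.
  have -> : b ^+ 2 * etat eta ^+ 2 * leverage C x h =
      (b * (etat eta * Num.sqrt (leverage C x h))) ^+ 2.
    by rewrite !exprMn sqr_sqrtr// mulrA.
  by rewrite ler_sqr ?nnegrE// mulr_ge0 ?ltW// (lt_le_trans ltr01).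
have : leverage C x h <= b ^+ 2 * etat eta ^+ 2 * leverage C x h by rewrite ler_peMl.
move: W2 N2; set G := leverage C x h; set K := b ^+ 2 * _ => W2 N2 gK.
have -> : inner theta (x t) + N - W - inner theta (x t) = N - W by ring.
have : (N - W) ^+ 2 <= 2 * N ^+ 2 + 2 * W ^+ 2.
  by have := sqr_ge0 (N + W); nra.
by nra.
Qed.

End Run.

(** * One-step exponential moments of a query bit *)

Section ExponentialInequalities.
Context {R : realType}.
Implicit Types p z : R.

Lemma expR_half_le2 : expR (1 / 2) <= 2 :> R.
Proof.
have := expR_ge1Dx (- (1 / 2) : R); rewrite expRN => h.
rewrite -[leRHS]invrK -[leLHS]invrK lef_pV2 ?posrE ?invr_gt0 ?expR_gt0//.
by apply: le_trans h; lra.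
Qed.

(** Through exp (- z) <= 1 / (1 + z). *)
Lemma expRN_le_half z : 0 <= z <= 1 -> expR (- z) <= 1 - z / 2.
Proof.
move=> /andP[z0 z1]; rewrite expRN.
have e1 : 1 + z <= expR z by exact: expR_ge1Dx.
have e0 : 0 < 1 + z by lra.
apply: (@le_trans _ _ (1 + z)^-1); first by rewrite lef_pV2 ?posrE ?expR_gt0.
by rewrite -div1r ler_pdivrMr//; nra.
Qed.

(** For a bit q of mean p, the expectation of exp (- q z) is at most 1 - p z / 2, hence at most exp
    (- p z / 2). *)
Lemma expR_lower_step p z : 0 <= p <= 1 -> 0 <= z <= 1 ->
  p * expR (p * z / 2 - z) + (1 - p) * expR (p * z / 2) <= 1.
Proof.
move=> /andP[p0 p1] z01; have ez := expRN_le_half z z01; have /andP[z0 z1] := z01.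
have pz := expR_ge1Dx (- (p * z / 2)).
have E0 := expR_gt0 (p * z / 2).
have EE : expR (p * z / 2) * expR (- (p * z / 2)) = 1 by rewrite expRxMexpNx_1.
rewrite expRD.
have : expR (p * z / 2) * (p * expR (- z) + (1 - p)) <= 1.
  rewrite -[leRHS]EE ler_pM2l//; apply: le_trans pz.
  by have := ler_wpM2l p0 ez; lra.
by lra.
Qed.

(** For a bit q of mean p, the expectation of exp (q / 2) is at most 1 + p, hence at most exp p. The
    form [0 / 2] is the exponent at a false bit. *)
Lemma expR_upper_step p : 0 <= p <= 1 ->
  p * expR (1 / 2 - p) + (1 - p) * expR (0 / 2 - p) <= 1.
Proof.
move=> /andP[p0 p1]; rewrite mul0r add0r expRD.
have E0 := expR_gt0 (- p).
have EE : expR (- p) * expR p = 1 by rewrite mulrC expRxMexpNx_1.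
have : expR (- p) * (p * expR (1 / 2) + (1 - p)) <= 1.
  rewrite -[leRHS]EE ler_pM2l//; apply: le_trans (expR_ge1Dx p).
  by have := ler_wpM2l p0 expR_half_le2; lra.
by lra.
Qed.

End ExponentialInequalities.

(** * Query and width sums over one group *)

Section GroupSums.
Context {R : realType} {I : finType}.
Variable G : pred I.

Lemma sqr_sum_le_card (a : I -> R) :
  (\sum_(i | G i) a i) ^+ 2 <= #|G|%:R * \sum_(i | G i) a i ^+ 2.
Proof.
set A := \sum_(i | G i) a i; set S := \sum_(i | G i) a i ^+ 2; set n := #|G|%:R.
have [n0|n0] := eqVneq (n : R) 0.
  have G0 : G =1 pred0.
    by apply/pred0P; rewrite /pred0b -(pnatr_eq0 R) -/n n0.
  by rewrite n0 mul0r /A big_pred0// expr2 mul0r.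
have np : 0 < n :> R by rewrite lt_def n0 ler0n.
have : 0 <= \sum_(i | G i) (n * a i - A) ^+ 2 by apply: sumr_ge0 => i _; exact: sqr_ge0.
have -> : \sum_(i | G i) (n * a i - A) ^+ 2 = n * (n * S - A ^+ 2).
  transitivity (\sum_(i | G i) (n ^+ 2 * a i ^+ 2 + (- (2 * n * A) * a i + A ^+ 2))).
    by apply: eq_bigr => i _; ring.
  rewrite !big_split/= -!mulr_sumr sumr_const -mulr_natr -/n -/S -/A; ring.
by rewrite pmulr_rge0// subr_ge0.
Qed.

Variables (z p D : I -> R) (E alpha c : R) (k : nat).
Hypotheses (E1 : 1 <= E) (alpha0 : 0 < alpha) (c1 : 1 <= c).
Hypothesis z01 : forall i, 0 <= z i <= 1.
Hypothesis DE : forall i, D i = E ^+ 2 * z i.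
Hypothesis pE : forall i, p i = Num.min 1 (alpha * D i).
Hypothesis S_le : \sum_(i | G i) p i * z i <= c * k%:R.
Let n : R := #|G|%:R.

Let D0 i : 0 <= D i.
Proof. by rewrite DE mulr_ge0 ?sqr_ge0//; have /andP[] := z01 i. Qed.

Let p0 i : 0 <= p i.
Proof. by rewrite pE le_min ler01; apply: mulr_ge0 => //; exact: ltW. Qed.

Let SD_le : \sum_(i | G i) p i * D i <= c * (E ^+ 2 * k%:R).
Proof.
under eq_bigr do rewrite DE mulrCA.
by rewrite -mulr_sumr mulrCA ler_wpM2l ?sqr_ge0.
Qed.

(** Since c >= 1, c may be replaced by c^2 before taking the root. *)
Let sqrt_bound (a b : R) : 0 <= a -> 0 <= b -> a ^+ 2 <= c * E ^+ 2 * b ->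
  a <= c * (E * Num.sqrt b).
Proof.
move=> a0 b0 ab.
have ecb : 0 <= c * (E * Num.sqrt b).
  apply: mulr_ge0; first exact: le_trans ler01 c1.
  by apply: mulr_ge0; [exact: le_trans ler01 E1|exact: sqrtr_ge0].
rewrite -ler_sqr ?nnegrE//; apply: le_trans ab _.
rewrite !exprMn sqr_sqrtr// mulrA ler_wpM2r// ler_wpM2r ?sqr_ge0//.
by rewrite expr2 ler_peMr// (le_trans ler01).
Qed.

(** From p <= alpha D one gets p^2 <= alpha p D, and Cauchy-Schwarz turns the bound on the sum of p
    D into one on the sum of p. The other branch of the minimum is p <= 1. *)
Lemma group_query_bound :
  \sum_(i | G i) p i <= c * Num.min n (E * Num.sqrt (alpha * k%:R * n)).
Proof.
have n0 : 0 <= n by [].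
have sp : \sum_(i | G i) p i <= n.
  rewrite /n -sum1_card natr_sum; apply: ler_sum => i _.
  by rewrite pE ge_min lexx.
have sq : \sum_(i | G i) p i <= c * (E * Num.sqrt (alpha * k%:R * n)).
  apply: sqrt_bound; [exact: sumr_ge0|by rewrite mulr_ge0// mulr_ge0// ltW|].
  apply: le_trans (sqr_sum_le_card p) _.
  have : \sum_(i | G i) p i ^+ 2 <= alpha * (c * (E ^+ 2 * k%:R)).
    apply: le_trans (_ : alpha * \sum_(i | G i) p i * D i <= _); last first.
      by rewrite ler_pM2l.
    rewrite mulr_sumr; apply: ler_sum => i _.
    by rewrite expr2 mulrCA ler_wpM2l// {1}pE ge_min lexx orbT.
  move=> h; have := ler_wpM2l n0 h; rewrite -/n; lra.
rewrite minr_pMr ?(le_trans ler01 c1)//.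
by rewrite le_min sq andbT; apply: le_trans sp _; rewrite ler_peMl.
Qed.

(** If p = 1 then D = p D; otherwise p = alpha D, so D is the square root of p D / alpha. The first
    kind is summed directly, the second by Cauchy-Schwarz; the factor 2 bounds a sum by a
    maximum. *)
Lemma group_regret_bound :
  \sum_(i | G i) D i
  <= 2 * c * Num.max (E ^+ 2 * k%:R) (E * Num.sqrt (k%:R * n / alpha)).
Proof.
have n0 : 0 <= n by [].
pose r i := Num.sqrt (p i * D i / alpha).
have r0 i : 0 <= p i * D i / alpha by rewrite mulr_ge0 ?mulr_ge0// invr_ge0 ltW.
have Dr i : D i <= p i * D i + r i.
  have [aD|aD] := leP 1 (alpha * D i).
    have -> : p i = 1 by rewrite pE; apply/min_idPl.
    by rewrite mul1r lerDl sqrtr_ge0.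
  have pa : p i = alpha * D i by rewrite pE; apply/min_idPr; exact: ltW.
  rewrite /r {2}pa (_ : _ / alpha = D i ^+ 2); last by field; rewrite gt_eqF.
  by rewrite sqrtr_sqr ger0_norm// lerDr mulr_ge0.
have sr : \sum_(i | G i) r i <= c * (E * Num.sqrt (k%:R * n / alpha)).
  apply: sqrt_bound; first by apply: sumr_ge0 => i _; exact: sqrtr_ge0.
    by rewrite mulr_ge0 ?mulr_ge0// invr_ge0 ltW.
  apply: le_trans (sqr_sum_le_card r) _.
  under eq_bigr do rewrite sqr_sqrtr//.
  rewrite -mulr_suml -/n.
  have ia : 0 <= alpha^-1 by rewrite invr_ge0 ltW.
  have := ler_wpM2l n0 (ler_wpM2r ia SD_le).
  move=> h; apply: le_trans h _; rewrite le_eqVlt; apply/orP; left; apply/eqP; ring.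
apply: (@le_trans _ _ (c * (E ^+ 2 * k%:R) + c * (E * Num.sqrt (k%:R * n / alpha)))).
  apply: le_trans (_ : \sum_(i | G i) (p i * D i + r i) <= _); first exact: ler_sum.
  by rewrite big_split/= lerD.
have c0 : 0 <= c by exact: le_trans ler01 c1.
set X := Num.max _ _; have -> : 2 * c * X = c * X + c * X by ring.
by apply: lerD; apply: ler_wpM2l => //; rewrite le_max lexx ?orbT.
Qed.

End GroupSums.

(** * Estimates on the logarithmic factor *)

Section LogFactor.
Context {R : realType}.
Variables (T : nat) (C delta : R).
Hypotheses (C0 : 0 < C) (delta01 : 0 < delta < 1).
Local Notation L := (logfactor T delta C).

Let d0 : 0 < delta^-1. Proof. by case/andP: delta01; rewrite invr_gt0. Qed.
Let T0 : 0 <= T%:R :> R. Proof. by []. Qed.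
Let lT : 0 <= ln (1 + T%:R : R). Proof. by rewrite ln_ge0// lerDl. Qed.
Let ld : 0 <= ln (1 + delta^-1). Proof. by rewrite ln_ge0// lerDl ltW. Qed.
Let lC : 0 <= ln (1 + C). Proof. by rewrite ln_ge0// lerDl ltW. Qed.

Lemma logfactor_ge1 : 1 <= L.
Proof. by rewrite /logfactor; move: lT ld lC; lra. Qed.

Lemma ln_TC_le_logfactor : ln (1 + T%:R) + ln (1 + C) <= L.
Proof. by rewrite /logfactor; move: lT ld lC; lra. Qed.

(** Of the two factors [expR L], one is at least 2 T / delta and the other at least 2; both follow
    from [e2], where the 2 comes from the summand 1 of the logarithmic factor. *)
Lemma markov_level_le_expR : 4 * T%:R / delta <= expR (2 * L).
Proof.
have e2 : 2 * (1 + T%:R) * (1 + delta^-1) <= expR L.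
  apply: (@le_trans _ _ (expR (1 + ln (1 + T%:R) + ln (1 + delta^-1)))).
    rewrite !expRD !lnK ?posrE//; try by move: T0 d0; lra.
    do 2 (apply: ler_wpM2r; first by move: T0 d0; lra).
    by apply: le_trans (expR_ge1Dx 1); lra.
  by rewrite ler_expR /logfactor; move: lC; lra.
have -> : 2 * L = L + L by ring.
rewrite expRD; have := d0; have := T0.
have td : 0 <= T%:R * delta^-1 by rewrite mulr_ge0// ltW.
move=> t0 i0; have e0 : 2 <= expR L by apply: le_trans e2; nra.
by nra.
Qed.

End LogFactor.

(** * Deterministic bounds on the good event *)

Section FinalBounds.
Context {R : realType} {d T m : nat}.
Variables (C eta delta alpha : R) (theta : 'rV[R]_d) (x : nat -> 'rV[R]_d).
Variables (part : 'I_T -> 'I_m) (du : 'I_m -> nat) (xiv uv : nat -> R).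
Hypotheses (C0 : 0 < C) (delta01 : 0 < delta < 1) (alpha0 : 0 < alpha).
Hypothesis thetaC : norm2 theta <= C.
Hypothesis x1 : forall t, (t < T)%N -> norm2 (x t) <= 1.
Hypothesis thetax : forall t, (t < T)%N -> `|inner theta (x t)| <= 1.
Hypothesis dims : forall u : 'I_m, exists V : 'M[R]_(du u, d),
  \rank V = du u /\ forall t : 'I_T, part t = u -> (x t <= V)%MS.

(** Extends the partition from ['I_T] to [nat], where the rounds of a history live. *)
Definition in_part (u : 'I_m) (t : nat) : bool :=
  [exists i : 'I_T, ((i : nat) == t) && (part i == u)].

Lemma in_part_ord u (t : 'I_T) : in_part u t = (part t == u).
Proof.
apply/existsP/idP => [[i /andP[/eqP/val_inj -> //]]|tu].
by exists t; rewrite eqxx.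
Qed.

Let p := query_prob C eta alpha x.
Let z h := Num.min 1 (leverage C x h).
Local Notation L := (logfactor T delta C).

Definition potential_exponent (u : 'I_m) (h : seq bool) (b : bool) : R :=
  (in_part u (size h))%:R * (p h * z h / 2 - b%:R * z h).

Definition query_exponent (h : seq bool) (b : bool) : R := b%:R / 2 - p h.

Let hst := hist p uv.
Hypothesis potential_le : forall u, hsum (potential_exponent u) (hst T) <= 2 * L.
Hypothesis query_le : hsum query_exponent (hst T) <= 2 * L.
Hypothesis noise_le : forall t, (t < T)%N ->
  `|noise_scale C eta x (hst t) * noise_sum C x xiv (hst t)| <= 3 * L.

Let Tu (u : 'I_m) : R := #|[pred t : 'I_T | part t == u]|%:R.

Let L1 : 1 <= L. Proof. exact: logfactor_ge1. Qed.

Let z01 h : 0 <= z h <= 1.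
Proof. by rewrite /z le_min ler01 leverage_ge0// ge_min lexx. Qed.

(** The sum of p z is twice the exponent sum plus twice the sum of q z, hence at most 4 L + 8 d_u L,
    and d_u >= 1 absorbs the first term. *)
Lemma group_potential_bound u :
  \sum_(t < T | part t == u) p (hst t) * z (hst t) <= 12 * L * (du u)%:R.
Proof.
have [V [_ xV]] := dims u.
(* In dimension 0 the term 4 L cannot be absorbed, but all inputs of the group are zero and so is
   the sum. *)
have [d0|d0] := eqVneq (du u) 0%N.
  rewrite d0 mulr0 big1// => t /eqP tu.
  have xt0 : x t = 0.
    have /submxP[w ->] := xV t tu; move: w V {xV}; rewrite d0 => w V.
    by rewrite [V]flatmx0 mulmx0.
  have -> : z (hst t) = 0 by rewrite /z /leverage size_hist xt0 mul0mx inner0l; apply/min_idPr.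
  by rewrite mulr0.
have ell : hsum (fun h b => (b && in_part u (size h))%:R * z h) (hst T) <= 4 * (du u)%:R * L.
  apply: le_trans (elliptical_potential C x V (in_part u) _ C0 _ _) _.
  - move=> t; rewrite size_hist => tT.
    by rewrite (in_part_ord u (Ordinal tT)) => /eqP tu; exact: (xV (Ordinal tT)).
  - by move=> t; rewrite size_hist; exact: x1.
  - by rewrite size_hist ler_wpM2l ?mulr_ge0// ln_TC_le_logfactor.
have key : hsum (fun h _ => (in_part u (size h))%:R * (p h * z h)) (hst T) =
    2 * hsum (potential_exponent u) (hst T) +
    2 * hsum (fun h b => (b && in_part u (size h))%:R * z h) (hst T).
  rewrite -!hsumZ -hsumD; elim: (hst T) => //= b h ->; congr (_ + _).
  rewrite /potential_exponent; case: (in_part u (size h)); case: b => /=; lra.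
have -> : \sum_(t < T | part t == u) p (hst t) * z (hst t) =
    hsum (fun h _ => (in_part u (size h))%:R * (p h * z h)) (hst T).
  rewrite hsum_hist big_mkcond; apply: eq_bigr => t _.
  by rewrite size_hist in_part_ord; case: eqP => _; rewrite ?mul1r ?mul0r.
have k1 : 1 <= (du u)%:R :> R by rewrite ler1n lt0n.
have := potential_le u; rewrite key.
have Lk : L <= L * (du u)%:R by rewrite ler_peMr// (le_trans ler01 L1).
move: ell Lk; set A := hsum _ _; set B := hsum _ _; lra.
Qed.

(** The query count is twice the exponent sum plus twice the sum of p, at most 4 L + 24 L S; the
    added 1 in the statement absorbs 4 L. The factor 24 L is enlarged to the one of the regret
    bound. *)
Lemma query_complexity_bound :
  query_complexity C eta alpha theta x xiv uv T <= 864 * L ^+ 3 *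
    (\sum_(u < m) Num.min (Tu u) (etat eta * Num.sqrt (alpha * (du u)%:R * Tu u)) + 1).
Proof.
set S := \sum_(u < m) _.
have c1 : 1 <= 12 * L by have := L1; lra.
have S0 : 0 <= S.
  apply: sumr_ge0 => u _; rewrite le_min ler0n mulr_ge0 ?sqrtr_ge0//.
  exact: le_trans ler01 (etat_ge1 eta).
have sp : \sum_(t < T) p (hst t) <= 12 * L * S.
  rewrite (partition_big part xpredT)//= mulr_sumr; apply: ler_sum => u _.
  apply: (group_query_bound _ (fun t : 'I_T => z (hst t)) (fun t : 'I_T => p (hst t))
    (fun t : 'I_T => Delta eta x t (design C x (hst t)))) => //.
  - exact: etat_ge1.
  - by move=> t; rewrite -[in Delta _ _ _](size_hist p uv t) DeltaE.
  - by move=> t; rewrite /p /query_prob size_hist.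
  - exact: group_potential_bound.
have Q : query_complexity C eta alpha theta x xiv uv T =
    2 * hsum query_exponent (hst T) + 2 * \sum_(t < T) p (hst t).
  rewrite query_complexity_hist -/p -/hst -(hsum_hist p (fun h _ => p h)) -/hst -!hsumZ -hsumD.
  by elim: (hst T) => //= b h ->; congr (_ + _); rewrite /query_exponent; lra.
have L3 : L <= L ^+ 3 by rewrite -[leLHS]expr1; apply: ler_weXn2l.
rewrite Q; move: query_le; set A := hsum _ _ => A_le.
apply: (@le_trans _ _ (24 * L * (S + 1))).
  by move: sp L1; set P := \sum_(t < T) _; nra.
have : L * (S + 1) <= L ^+ 3 * (S + 1) by rewrite ler_wpM2r// addr_ge0.
by have : 0 <= L ^+ 3 * (S + 1); [rewrite mulr_ge0 ?addr_ge0 ?exprn_ge0// (le_trans ler01)|lra].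
Qed.

(** [prediction_error] with b = 3 L costs 36 L^2 and the sum of the widths costs 24 L, whence 864
    L^3. *)
Lemma regret_bound :
  regret C eta alpha theta x xiv uv T <= 864 * L ^+ 3 *
    \sum_(u < m) Num.max (etat eta ^+ 2 * (du u)%:R)
      (etat eta * Num.sqrt ((du u)%:R * Tu u / alpha)).
Proof.
set S := \sum_(u < m) _.
have c1 : 1 <= 12 * L by have := L1; lra.
have sD : \sum_(t < T) Delta eta x t (design C x (hst t)) <= 2 * (12 * L) * S.
  rewrite (partition_big part xpredT)//= mulr_sumr; apply: ler_sum => u _.
  apply: (group_regret_bound _ (fun t : 'I_T => z (hst t)) (fun t : 'I_T => p (hst t))
    (fun t : 'I_T => Delta eta x t (design C x (hst t)))) => //.
  - exact: etat_ge1.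
  - by move=> t; rewrite -[in Delta _ _ _](size_hist p uv t) DeltaE.
  - by move=> t; rewrite /p /query_prob size_hist.
  - exact: group_potential_bound.
apply: (@le_trans _ _ (4 * (3 * L) ^+ 2 *
    \sum_(t < T) Delta eta x t (design C x (hst t)))).
  rewrite mulr_sumr; apply: ler_sum => t _.
  by apply: prediction_error => //; [move: L1; lra|exact: thetax|exact: noise_le].
have : 4 * (3 * L) ^+ 2 * \sum_(t < T) Delta eta x t (design C x (hst t))
    <= 4 * (3 * L) ^+ 2 * (2 * (12 * L) * S).
  by rewrite ler_wpM2l// mulr_ge0// sqr_ge0.
move=> h; apply: le_trans h _; rewrite le_eqVlt; apply/orP; left; apply/eqP; ring.
Qed.

End FinalBounds.

Theorem theorem1 :
  exists K k : nat,
  forall (R : realType) (d T m : nat) (C eta delta alpha : R)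
    (theta : 'rV[R]_d) (x : nat -> 'rV[R]_d)
    (part : 'I_T -> 'I_m) (du : 'I_m -> nat)
    (dT : measure_display) (Omega : measurableType dT) (P : probability Omega R)
    (xi U : nat -> Omega -> R),
    (1 <= d)%N -> (1 <= T)%N -> 0 < C -> 0 <= eta -> 0 < delta < 1 -> 0 < alpha ->
    norm2 theta <= C ->
    (forall t, (t < T)%N -> norm2 (x t) <= 1) ->
    (forall t, (t < T)%N -> `|inner theta (x t)| <= 1) ->
    (forall u : 'I_m, exists t : 'I_T, part t = u) ->
    (forall u : 'I_m, exists V : 'M[R]_(du u, d),
        \rank V = du u /\ forall t : 'I_T, part t = u -> (x t <= V)%MS) ->
    (forall t, (t < T)%N -> zero_mean_subgaussian P (xi t) eta) ->
    (forall t, (t < T)%N -> uniform01 P (U t)) ->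
    mutually_independent P [set i : bool * nat | (i.2 < T)%N]
      (fun i => if i.1 then xi i.2 else U i.2) ->
    let Tu (u : 'I_m) : R := (#|[pred t : 'I_T | part t == u]|)%:R in
    let L := logfactor T delta C in
    exists E : set Omega, measurable E /\ ((1 - delta)%:E <= P E)%E /\
      forall w, E w ->
        query_complexity C eta alpha theta x (fun t => xi t w) (fun t => U t w) T
          <= K%:R * L ^+ k *
             (\sum_(u < m) Num.min (Tu u)
                 (etat eta * Num.sqrt (alpha * (du u)%:R * Tu u)) + 1)
        /\
        regret C eta alpha theta x (fun t => xi t w) (fun t => U t w) T
          <= K%:R * L ^+ k *
             \sum_(u < m) Num.max (etat eta ^+ 2 * (du u)%:R)
                 (etat eta * Num.sqrt ((du u)%:R * Tu u / alpha)).
Proof.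
exists 864%N, 3%N => R d T m C eta delta alpha theta x part du dT Omega P xi U.
move=> _ T1 C0 eta0 delta01 alpha0 thetaC x1 thetax part_surj dims subg unif indep Tu L.
have /andP[delta0 delta1] := delta01.
have T0 : 0 < T%:R :> R by rewrite ltr0n.
(* The parts are nonempty; this keeps the number of controlled quantities linear in [T]. *)
have mT : (m <= T)%N.
  have [g gK] := choice part_surj.
  by have := leq_card g (can_inj gK); rewrite !card_ord.
pose p := query_prob C eta alpha x.
have p01 h : 0 <= p h <= 1 by exact: query_prob01.
(* One exponent per group, and [None] for the total query count. *)
pose F (o : option 'I_m) := if o is Some u
  then potential_exponent C eta alpha x part u else query_exponent C eta alpha x.
pose sg (b : bool) : R := if b then 1 else -1.
(* Dropping the latest [T - j.1] bits recovers the past of round [j.1]; the sign gives both sides of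
   an absolute value. *)
pose c (j : 'I_T * bool) (h : seq bool) (s : nat) : R :=
  let h' := drop (T - j.1) h in
  sg j.2 * (noise_scale C eta x h' * ((bit_at h' s)%:R * inner (dual_dir C x h') (x s))).
have [||||E [mE PE EP]] := history_tail_bound P T eta xi U p p01 subg unif indep
    _ _ F c (4 * T%:R / delta) delta.
- case=> [u|] h /=; last exact: expR_upper_step.
  rewrite /potential_exponent; case: (in_part part u (size h)).
    rewrite !mul1r mul0r subr0; apply: expR_lower_step => //.
    by rewrite min1_leverage_ge0// ge_min lexx.
  by rewrite !mul0r expR0; lra.
- move=> j h hT.
  have -> : \sum_(t < T) c j h t ^+ 2 = \sum_(s < T) (noise_scale C eta x (drop (T - j.1) h) *
      ((bit_at (drop (T - j.1) h) s)%:R * inner (dual_dir C x (drop (T - j.1) h)) (x s))) ^+ 2.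
    apply: eq_bigr => s _; rewrite /c exprMn (_ : sg j.2 ^+ 2 = 1) ?mul1r//.
    by rewrite /sg; case: j.2; rewrite ?sqrrN expr1n.
  by apply: noise_coef_bound => //; rewrite size_drop hT leq_subr.
- by rewrite divr_gt0// mulr_gt0.
(* There are m + 1 + 2 T quantities, at most 4 T. *)
- rewrite divfK ?gt_eqF// card_option card_prod card_bool !card_ord natrM -natr1.
  have : m%:R <= T%:R :> R by rewrite ler_nat.
  have : 1 <= T%:R :> R by rewrite ler1n.
  by lra.
exists E; split=> //; split=> // w Ew.
have [Fw cw] := EP w Ew; set h := hist _ _ _ in Fw cw.
have expL y : expR y <= 4 * T%:R / delta -> y <= 2 * L.
  by move=> yB; rewrite -ler_expR (le_trans yB)// markov_level_le_expR.
have noise t : (t < T)%N -> `|noise_scale C eta x (hist p (fun t => U t w) t) *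
    noise_sum C x (fun t => xi t w) (hist p (fun t => U t w) t)| <= 3 * L.
  move=> tT; set h' := hist p _ t.
  have sumE b : \sum_(s < T) c (Ordinal tT, b) h s * xi s w =
      sg b * (noise_scale C eta x h' * noise_sum C x (fun t => xi t w) h').
    have h'E : drop (T - t) h = h' by rewrite drop_hist// ltnW.
    rewrite /noise_sum.
    rewrite (@hsum_bit_at _ (fun s => inner (dual_dir C x h') (x s) * xi s w) h' T);
      last first.
      by rewrite size_hist ltnW.
    rewrite !mulr_sumr; apply: eq_bigr => s _; rewrite /c /= h'E; ring.
  (* The tail bound gives 2 L + 1 / 2 for either sign, at most 3 L. *)
  have L1 : 1 <= L by exact: logfactor_ge1.
  have := expL _ (cw (Ordinal tT, true)); have := expL _ (cw (Ordinal tT, false)).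
  rewrite !sumE /sg mul1r mulN1r => n1 n2.
  by rewrite ler_norml; apply/andP; split; lra.
split.
  apply: query_complexity_bound => //.
  - by move=> u; apply: expL; exact: (Fw (Some u)).
  - by apply: expL; exact: (Fw None).
apply: regret_bound => //.
by move=> u; apply: expL; exact: (Fw (Some u)).
Qed.
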